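(* For every $n\ge 3$, the Schur multiplier $M(\mathcal{G}_n)=H_2(\mathcal{G}_n,\mathbb{Z})$ satisfies $M(\mathcal{G}_n)\cong C_2^{2n-2}$.
   Context: Let $X=\{0,1\}$ and let $X^*$ be the set of finite words over $X$, viewed as the binary rooted tree (the root is the empty word, and the children of $w$ are $w0,w1$). The Grigorchuk group $\mathcal{G}\le \mathrm{Aut}(X^* )$ is the group generated by the tree automorphisms $a,b,c,d$ defined recursively for $w\in X^*$ by: $a(0w)=1w$, $a(1w)=0w$; $b(0w)=0\,a(w)$, $b(1w)=1\,c(w)$; $c(0w)=0\,a(w)$, $c(1w)=1\,d(w)$; $d(0w)=0w$, $d(1w)=1\,b(w)$ (all fix the empty word). For $n\ge1$, $St_{\mathcal{G}}(n)$ is the normal subgroup of elements of $\mathcal{G}$ fixing every word of length $n$, and $\mathcal{G}_n=\mathcal{G}/St_{\mathcal{G}}(n)$. $C_2$ is the cyclic group of order $2$ and $C_2^{m}$ its $m$-fold direct product. *)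

(* Defs.v *)
From HB Require Import structures.
From mathcomp Require Import all_boot all_algebra.
From mathcomp Require Import boolp.
From mathcomp.multinomials Require Import freeg.

Set Implicit Arguments.
Unset Strict Implicit.
Unset Printing Implicit Defensive.

Import GRing.Theory.

Local Open Scope group_scope.
Local Open Scope quotient_scope.

Section Generated.
Variable G : groupType.

Definition generated (S : seq G) : {pred G} :=
  fun g => `[< forall N : groupClosed G, {subset S <= N} -> g \in N >].

Lemma generated_group_closed (S : seq G) : group_closed (generated S).
Proof.
split=> [|g h /asboolP gS /asboolP hS]; apply/asboolP => N SN.
  exact: gpred1.
by apply: gpredF; [apply: gS | apply: hS].
Qed.

Variable S : seq G.

Record generatedGroup := GeneratedGroup {
  genval : G;
  genvalP : genval \in generated S }.

HB.instance Definition _ := [isSub for genval].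
HB.instance Definition _ := [Choice of generatedGroup by <:].
HB.instance Definition _ :=
  SubChoice_isSubGroup.Build G (generated S) generatedGroup
    (generated_group_closed S).

End Generated.

Section QuotientGroup.
Variables (G : groupType) (N : groupClosed G).
Hypothesis nN : forall x y : G, x \in N -> x ^ y \in N.

(* The left cosets x N; nN : N is normal. *)
Definition eq_coset (x y : G) := x^-1 * y \in N.

Lemma eq_coset_equiv : equiv_class_of eq_coset.
Proof.
split=> [x|x y|y x z]; rewrite /eq_coset.
- by rewrite mulVg gpred1.
- by rewrite -gpredV invgM invgK.
- by move=> xy yz; rewrite -[z](mulVKg y) mulgA gpredM.
Qed.

Canonical eq_coset_equivRel := EquivRelPack eq_coset_equiv.
Canonical eq_coset_encModRel := defaultEncModRel eq_coset.

Definition quotientGroup of (forall x y : G, x \in N -> x ^ y \in N) :=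
  {eq_quot eq_coset}.
Local Notation GN := (quotientGroup nN).

HB.instance Definition _ := Choice.on GN.
HB.instance Definition _ := EqQuotient.on GN.

Definition quotient_one : GN := \pi_GN 1.
Definition quotient_inv : GN -> GN := lift_op1 GN (fun x => x^-1).
Definition quotient_mul : GN -> GN -> GN := lift_op2 GN (fun x y => x * y).

Lemma quotient_eqE x y : \pi_GN x = \pi_GN y <-> x^-1 * y \in N.
Proof. by split=> /(@eqmodP _ eq_coset_equivRel). Qed.

Lemma repr_quotient x : x^-1 * repr (\pi_GN x) \in N.
Proof. by apply/quotient_eqE; rewrite reprK. Qed.

Lemma pi_quotient_inv x : \pi_GN (x^-1) = quotient_inv (\pi_GN x).
Proof.
unlock quotient_inv; apply/quotient_eqE; rewrite invgK.
have /(nN x^-1) := repr_quotient x.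
by rewrite /conjg invgK -(mulgA x^-1) mulVKg -gpredV invgM invgK.
Qed.

Lemma pi_quotient_mul x y : \pi_GN (x * y) = quotient_mul (\pi_GN x) (\pi_GN y).
Proof.
unlock quotient_mul; apply/quotient_eqE => /=.
have := repr_quotient x; have := repr_quotient y.
set u := repr (\pi_GN x); set v := repr (\pi_GN y) => yv xu.
have -> : (x * y)^-1 * (u * v) = (x^-1 * u) ^ y * (y^-1 * v).
  by rewrite /conjg invgM !mulgA mulgK.
by rewrite gpredM ?nN.
Qed.

Let quotient_ind (P : GN -> Prop) : (forall x, P (\pi_GN x)) -> forall u, P u.
Proof. by move=> Pp u; rewrite -[u]reprK. Qed.

Lemma quotient_mulgA : associative quotient_mul.
Proof.
elim/quotient_ind=> x; elim/quotient_ind=> y; elim/quotient_ind=> z.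
by rewrite -!pi_quotient_mul mulgA.
Qed.

Lemma quotient_mul1g : left_id quotient_one quotient_mul.
Proof. by elim/quotient_ind=> x; rewrite -pi_quotient_mul mul1g. Qed.

Lemma quotient_mulg1 : right_id quotient_one quotient_mul.
Proof. by elim/quotient_ind=> x; rewrite -pi_quotient_mul mulg1. Qed.

Lemma quotient_mulVg : left_inverse quotient_one quotient_inv quotient_mul.
Proof.
by elim/quotient_ind=> x; rewrite -pi_quotient_inv -pi_quotient_mul mulVg.
Qed.

Lemma quotient_mulgV : right_inverse quotient_one quotient_inv quotient_mul.
Proof.
by elim/quotient_ind=> x; rewrite -pi_quotient_inv -pi_quotient_mul mulgV.
Qed.

HB.instance Definition _ := isGroup.Build GN quotient_mulgA
  quotient_mul1g quotient_mulg1 quotient_mulVg quotient_mulgV.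

End QuotientGroup.

Definition word := seq bool.

(* Automorphisms of the rooted tree: bijections of the vertex set fixing the
   root and mapping children of w to children of the image of w; the last
   letter of a word is the one furthest from the root. *)
Definition tree_automorphism (f : word -> word) :=
  [/\ bijective f, f [::] = [::]
    & forall w x, exists y, f (rcons w x) = rcons (f w) y].

Record treeAut := TreeAut {
  taut :> word -> word;
  tautP : `[< tree_automorphism taut >] }.

HB.instance Definition _ := [isSub for taut].
HB.instance Definition _ := [Choice of treeAut by <:].

Lemma treeAutP (f : treeAut) : tree_automorphism f.
Proof. exact/asboolP/tautP. Qed.

Lemma treeAut_eqP (f g : treeAut) : f =1 g -> f = g.
Proof. by move=> /funext fg; apply: val_inj. Qed.

Lemma tree_automorphism_id : tree_automorphism id.
Proof. by split=> [||w x]; [exists id | | exists x]. Qed.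

Lemma tree_automorphism_comp f g :
  tree_automorphism f -> tree_automorphism g -> tree_automorphism (f \o g).
Proof.
move=> [bf f0 fc] [bg g0 gc]; split=> [||w x /=]; first exact: bij_comp.
  by rewrite /= g0.
by have [y ->] := gc w x; apply: fc.
Qed.

Lemma tree_automorphism_can f g :
  tree_automorphism f -> cancel f g -> cancel g f -> tree_automorphism g.
Proof.
move=> [bf f0 fc] fK gK; split=> [||w x]; first by exists f.
  by rewrite -[in LHS]f0 fK.
case/lastP E: (g (rcons w x)) => [|v y].
  by move: (congr1 f E); rewrite gK f0; case: w {E}.
have [y' fv] := fc v y.
move: (congr1 f E); rewrite gK fv => /rcons_inj[-> _].
by exists y; rewrite fK.
Qed.

Lemma size_treeAut (f : treeAut) w : size (f w) = size w.
Proof.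
have [_ f0 fc] := treeAutP f.
elim/last_ind: w => [|w x IHw]; first by rewrite f0.
by have [y ->] := fc w x; rewrite !size_rcons IHw.
Qed.

Lemma treeAut_inv_subproof (f : treeAut) :
  exists g : treeAut, cancel f g /\ cancel g f.
Proof.
have fP := treeAutP f; have [[g fK gK] _ _] := fP.
have gP := tree_automorphism_can fP fK gK.
by exists (TreeAut (introT (asboolP _) gP)).
Qed.

(* The product is composition, (f * g) w = f (g w): a left action on words. *)
Definition treeAut_one : treeAut :=
  TreeAut (introT (asboolP _) tree_automorphism_id).
Definition treeAut_mul (f g : treeAut) : treeAut :=
  TreeAut (introT (asboolP _)
    (tree_automorphism_comp (treeAutP f) (treeAutP g))).
Definition treeAut_inv (f : treeAut) : treeAut :=
  projT1 (cid (treeAut_inv_subproof f)).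

Lemma treeAut_mulA : associative treeAut_mul.
Proof. by move=> f g h; apply: treeAut_eqP. Qed.

Lemma treeAut_mul1 : left_id treeAut_one treeAut_mul.
Proof. by move=> f; apply: treeAut_eqP. Qed.

Lemma treeAut_mulr1 : right_id treeAut_one treeAut_mul.
Proof. by move=> f; apply: treeAut_eqP. Qed.

Lemma treeAut_mulV : left_inverse treeAut_one treeAut_inv treeAut_mul.
Proof.
by move=> f; apply: treeAut_eqP; rewrite /treeAut_inv; case: cid => g /= [].
Qed.

Lemma treeAut_mulrV : right_inverse treeAut_one treeAut_inv treeAut_mul.
Proof.
by move=> f; apply: treeAut_eqP; rewrite /treeAut_inv; case: cid => g /= [].
Qed.

HB.instance Definition _ := isGroup.Build treeAut treeAut_mulA
  treeAut_mul1 treeAut_mulr1 treeAut_mulV treeAut_mulrV.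

(* The letters 0 and 1 are false and true. *)
Definition grig_a_fun (w : word) : word :=
  if w is x :: w' then ~~ x :: w' else [::].

Fixpoint grig_b_fun (w : word) : word :=
  match w with
  | [::] => [::]
  | false :: w' => false :: grig_a_fun w'
  | true :: w' => true :: grig_c_fun w'
  end
with grig_c_fun (w : word) : word :=
  match w with
  | [::] => [::]
  | false :: w' => false :: grig_a_fun w'
  | true :: w' => true :: grig_d_fun w'
  end
with grig_d_fun (w : word) : word :=
  match w with
  | [::] => [::]
  | false :: w' => false :: w'
  | true :: w' => true :: grig_b_fun w'
  end.

Lemma involutive_tree_automorphism f : involutive f -> f [::] = [::] ->
  (forall w x, exists y, f (rcons w x) = rcons (f w) y) ->
  tree_automorphism f.
Proof. by move=> fK f0 fc; split=> //; exists f. Qed.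

Lemma grig_aP : tree_automorphism grig_a_fun.
Proof.
apply: involutive_tree_automorphism => // [[|x w] //=|[|y w] x /=].
- by rewrite negbK.
- by exists (~~ x).
- by exists x.
Qed.

Lemma grig_bcd_involutive w :
  [/\ grig_b_fun (grig_b_fun w) = w, grig_c_fun (grig_c_fun w) = w
    & grig_d_fun (grig_d_fun w) = w].
Proof.
have aK : involutive grig_a_fun by case=> //= x v; rewrite negbK.
by elim: w => // -[] w [bK cK dK] /=; rewrite ?bK ?cK ?dK ?aK.
Qed.

Lemma grig_bcd_child w x :
  [/\ exists y, grig_b_fun (rcons w x) = rcons (grig_b_fun w) y,
      exists y, grig_c_fun (rcons w x) = rcons (grig_c_fun w) y
    & exists y, grig_d_fun (rcons w x) = rcons (grig_d_fun w) y].
Proof.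
have [_ _ ac] := grig_aP.
elim: w => [|y w [[yb bE] [yc cE] [yd dE]]].
  by case: x; split; [exists true|exists true|exists true
                     |exists false|exists false|exists false].
have [ya aE] := ac w x.
by case: y => /=; rewrite ?aE ?bE ?cE ?dE; split;
   [exists yc|exists yd|exists yb|exists ya|exists ya|exists x].
Qed.

Lemma grig_bP : tree_automorphism grig_b_fun.
Proof.
by apply: involutive_tree_automorphism => // [w|w x];
  [case: (grig_bcd_involutive w) | case: (grig_bcd_child w x)].
Qed.

Lemma grig_cP : tree_automorphism grig_c_fun.
Proof.
by apply: involutive_tree_automorphism => // [w|w x];
  [case: (grig_bcd_involutive w) | case: (grig_bcd_child w x)].
Qed.

Lemma grig_dP : tree_automorphism grig_d_fun.
Proof.
by apply: involutive_tree_automorphism => // [w|w x];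
  [case: (grig_bcd_involutive w) | case: (grig_bcd_child w x)].
Qed.

Definition grig_a : treeAut := TreeAut (introT (asboolP _) grig_aP).
Definition grig_b : treeAut := TreeAut (introT (asboolP _) grig_bP).
Definition grig_c : treeAut := TreeAut (introT (asboolP _) grig_cP).
Definition grig_d : treeAut := TreeAut (introT (asboolP _) grig_dP).

Definition grigorchuk := generatedGroup [:: grig_a; grig_b; grig_c; grig_d].
HB.instance Definition _ := Group.on grigorchuk.

Definition level_stabilizer (n : nat) : {pred grigorchuk} :=
  fun g => [forall w : n.-tuple bool, genval g w == w :> word].

Lemma level_stabilizerP n (g : grigorchuk) :
  reflect (forall w : word, size w = n -> genval g w = w)
          (g \in level_stabilizer n).
Proof.
apply: (iffP forallP) => [gw w /eqP sw|gw w].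
  exact: (eqP (gw (Tuple sw))).
by rewrite gw ?size_tuple.
Qed.

Lemma level_stabilizer1 n : 1 \in level_stabilizer n.
Proof. by apply/level_stabilizerP. Qed.

Lemma level_stabilizerM n : mulg_closed (level_stabilizer n).
Proof.
move=> g h /level_stabilizerP gn /level_stabilizerP hn.
by apply/level_stabilizerP => w sw /=; rewrite hn ?gn.
Qed.

Lemma treeAutK (f : treeAut) : cancel f (f^-1).
Proof. by move=> w; rewrite -[LHS]/((f^-1 * f) w) mulVg. Qed.

Lemma level_stabilizerV n : invg_closed (level_stabilizer n).
Proof.
move=> g /level_stabilizerP gn.
apply/level_stabilizerP => w sw.
by rewrite -[in LHS](gn w sw) /= treeAutK.
Qed.

HB.instance Definition _ n :=
  isMulClosed.Build grigorchuk (level_stabilizer n) (@level_stabilizerM n).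
HB.instance Definition _ n :=
  isMul1Closed.Build grigorchuk (level_stabilizer n) (level_stabilizer1 n).
HB.instance Definition _ n :=
  isInvClosed.Build grigorchuk (level_stabilizer n) (@level_stabilizerV n).

Lemma level_stabilizer_normal n (x y : grigorchuk) :
  x \in level_stabilizer n -> x ^ y \in level_stabilizer n.
Proof.
move=> /level_stabilizerP xn; apply/level_stabilizerP => w sw /=.
by rewrite xn ?size_treeAut ?treeAutK.
Qed.

Definition grigorchuk_quotient (n : nat) :=
  quotientGroup (@level_stabilizer_normal n).
HB.instance Definition _ n := Group.on (grigorchuk_quotient n).

Local Open Scope ring_scope.

(* The inhomogeneous (unnormalized) bar complex with trivial coefficients Z:
   the i-th face of (g_1, ..., g_(k+1)) drops g_1 for i = 0, drops g_(k+1) for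
   i = k + 1, and multiplies g_i by g_(i+1) otherwise. *)
Section GroupHomology.
Variable G : groupType.

Definition bar_chain (k : nat) := {freeg (k.-tuple G)}.
HB.instance Definition _ k := GRing.Zmodule.on (bar_chain k).

Definition bar_face k (i : nat) (g : k.+1.-tuple G) : k.-tuple G :=
  [tuple if (j.+1 < i)%N then tnth g (widen_ord (leqnSn k) j)
         else if j.+1 == i
              then (tnth g (widen_ord (leqnSn k) j) * tnth g (fintype.lift ord0 j))%g
         else tnth g (fintype.lift ord0 j) | j < k].

Definition bar_boundary k : bar_chain k -> bar_chain k.-1 :=
  match k return bar_chain k -> bar_chain k.-1 with
  | 0 => fun=> 0
  | k'.+1 => fglift (fun g : k'.+1.-tuple G =>
      \sum_(i < k'.+2) (-1) ^+ i *: (<< bar_face i g >> : {freeg (k'.-tuple G)}))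
  end.

Lemma bar_boundary_zmod_morphism k : zmod_morphism (@bar_boundary k).
Proof.
by case: k => [|k] c1 c2; rewrite /bar_boundary ?subr0 // lift_is_additive.
Qed.

HB.instance Definition _ k := GRing.isZmodMorphism.Build (bar_chain k)
  (bar_chain k.-1) (@bar_boundary k) (@bar_boundary_zmod_morphism k).

Definition bar_cycle_pred k : {pred bar_chain k} :=
  fun c => bar_boundary c == 0.

Lemma bar_cycle_zmod_closed k : zmod_closed (@bar_cycle_pred k).
Proof.
split=> [|c1 c2]; rewrite !unfold_in ?raddf0 // => /eqP c10 /eqP c20.
by rewrite raddfB /= c10 c20 subrr.
Qed.

Record bar_cycle k := BarCycle {
  cycle_val : bar_chain k;
  cycle_valP : cycle_val \in @bar_cycle_pred k }.

HB.instance Definition _ k := [isSub for @cycle_val k].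
HB.instance Definition _ k := [Choice of bar_cycle k by <:].
HB.instance Definition _ k := GRing.SubChoice_isSubZmodule.Build
  (bar_chain k) (@bar_cycle_pred k) (bar_cycle k) (@bar_cycle_zmod_closed k).

Definition bar_bound k : {pred bar_cycle k} :=
  fun z => `[< exists c : bar_chain k.+1, cycle_val z = bar_boundary c >].

Lemma bar_bound_zmod_closed k : zmod_closed (@bar_bound k).
Proof.
split=> [|z1 z2 /asboolP[c1 E1] /asboolP[c2 E2]]; apply/asboolP.
  by exists 0; rewrite raddf0.
by exists (c1 - c2); rewrite !raddfB /= E1 E2.
Qed.

HB.instance Definition _ k := GRing.isZmodClosed.Build (bar_cycle k)
  (@bar_bound k) (@bar_bound_zmod_closed k).

(* H_k(G, Z): k-cycles modulo those k-cycles that bound a (k+1)-chain. *)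
Definition homology k := Quotient.quot (@bar_bound k).
HB.instance Definition _ k := GRing.Zmodule.on (homology k).

End GroupHomology.

Definition schur_multiplier (G : groupType) := homology G 2.
HB.instance Definition _ G := GRing.Zmodule.on (schur_multiplier G).

Definition zmod_isomorphic (U V : zmodType) :=
  exists f : {additive U -> V}, bijective f.

(* Main.v *)
(** Write G_n = Gamma / N_n, where Gamma is generated by a, b, c, d subject to
a^2 = b^2 = c^2 = d^2 = bcd = 1.  Lysenok's substitution s : a -> aca, b -> d,
c -> b, d -> c sends normal generators of N_n to normal generators of N_(n+1),
up to adding (ad)^4 and (adacac)^4; thus N_n is the normal closure of 2n - 3
fourth powers.  This follows from the wreath recursion w = (w_0, w_1): if
(ad)^4, (adacac)^4 and (ac)^8 hold, then any w with an even number of letters a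
is a product of homomorphic images of w_0 and w_1.

The 2n - 3 fourth powers and the commutator of b and c yield 2-cycles that
generate H_2(G_n, Z), because a cycle is determined by its image in the central
extension of G_n by 2-chains modulo boundaries.  These cycles have order at most
2 since every root of a relator is a product of two palindromes, hence of two
involutions.  They are independent: Gamma-invariant homomorphisms N_n -> F_2 are
detected on relators, such a homomorphism f yields one on N_(n+1) by
w |-> f(w_0) + f(w_1), which takes on s(r) the same value as f on r as soon as
f((ad)^4) = 0, and the few relators missed by this construction are separated by
explicit finite central extensions. *)

From HB Require Import structures.
Require Import Defs.
From mathcomp Require Import all_boot perm all_algebra.
From mathcomp Require Import boolp.
From mathcomp.multinomials Require Import freeg.

Set Implicit Arguments.
Unset Strict Implicit.
Unset Printing Implicit Defensive.

Import GRing.Theory.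

Local Open Scope group_scope.

(** * Words and sections *)

Inductive letter := La | Lb | Lc | Ld.

Definition letterword := seq letter.

Fixpoint odd_a (w : letterword) : bool :=
  if w is l :: w' then (if l is La then ~~ odd_a w' else odd_a w') else false.

Definition letter_section (l : letter) (x : bool) : letterword :=
  match l, x with
  | La, _ => [::]
  | Lb, false => [:: La]
  | Lb, true => [:: Lc]
  | Lc, false => [:: La]
  | Lc, true => [:: Ld]
  | Ld, false => [::]
  | Ld, true => [:: Lb]
  end.

(** Words act from their right end, so [l] meets the first tree letter after the letters [a] of [w']
    have flipped it. *)
Fixpoint section (x : bool) (w : letterword) : letterword :=
  if w is l :: w' then letter_section l (x (+) odd_a w') ++ section x w'
  else [::].

Definition grig_fun (l : letter) : word -> word :=
  match l with
  | La => grig_a_fun | Lb => grig_b_fun | Lc => grig_c_fun | Ld => grig_d_fun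
  end.

Definition act_word (w : letterword) (x : word) : word :=
  foldr (fun l y => grig_fun l y) x w.

Definition trivial_on (n : nat) (w : letterword) : Prop :=
  forall x : word, size x = n -> act_word w x = x.

Lemma act_word_cat u v x : act_word (u ++ v) x = act_word u (act_word v x).
Proof. by rewrite /act_word foldr_cat. Qed.

Lemma odd_a_cat u v : odd_a (u ++ v) = odd_a u (+) odd_a v.
Proof. by elim: u => //= -[] u ->; rewrite ?addNb. Qed.

Lemma section_cat x u v :
  section x (u ++ v) = section (x (+) odd_a v) u ++ section x v.
Proof. by elim: u => //= l u ->; rewrite catA odd_a_cat addbCA addbC -addbA. Qed.

Lemma act_word_section w x v :
  act_word w (x :: v) = (x (+) odd_a w) :: act_word (section x w) v.
Proof.
elim: w => [|l w IHw] /=; first by rewrite addbF.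
rewrite IHw act_word_cat.
by case: l => /=; case: (x (+) odd_a w) (addbN x (odd_a w)) => //= ->.
Qed.

Lemma trivial_onS n w :
  trivial_on n.+1 w <-> ~~ odd_a w /\ forall x, trivial_on n (section x w).
Proof.
split=> [tw | [ow tw] [|x v] // [sv]].
  have ow : ~~ odd_a w.
    have /= := tw (nseq n.+1 false) (size_nseq _ _).
    by rewrite act_word_section => -[->].
  split=> // x v sv; have := tw (x :: v); rewrite /= sv act_word_section.
  by move=> /(_ erefl) [].
by rewrite act_word_section (negbTE ow) addbF tw.
Qed.

Lemma trivial_on_le m n w : n <= m -> trivial_on m w -> trivial_on n w.
Proof.
elim: n m w => [|n IHn] [|m] w //; first by move=> _ _ x /size0nil->;
    elim: w => //= -[] w ->.
rewrite ltnS => nm /trivial_onS[ow tw]; apply/trivial_onS; split=> // x.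
exact: IHn nm (tw x).
Qed.

Definition odd_cd (w : letterword) : bool :=
  foldr (fun l e => (if l is (Lc | Ld) then ~~ e else e)) false w.

Lemma odd_cd_cat u v : odd_cd (u ++ v) = odd_cd u (+) odd_cd v.
Proof. by elim: u => //= -[] u ->; rewrite ?addNb. Qed.

(** The letters [c] and [d] of one section come from [b = (a, c)] and [c = (a, d)], which put an [a]
    into the other section. *)
Lemma odd_cd_section x w : odd_cd (section x w) = odd_a (section (~~ x) w).
Proof.
elim: w => //= l w IHw; rewrite odd_cd_cat odd_a_cat IHw addNb.
by case: l => /=; case: (x (+) odd_a w).
Qed.

(** * Evaluation of words in a group, and dihedral groups of order dividing 8 *)

Section Eval.
Variable Q : groupType.
Implicit Types (q : letter -> Q) (w : letterword).

Definition ev q w : Q := foldr (fun l x => q l * x) 1 w.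

Lemma ev_cat q u v : ev q (u ++ v) = ev q u * ev q v.
Proof. by elim: u => [|l u IHu] /=; rewrite ?mul1g // IHu mulgA. Qed.

Lemma eq_ev q q' w : q =1 q' -> ev q w = ev q' w.
Proof. by move=> qq; elim: w => //= l w ->; rewrite qq. Qed.

Lemma ev_conj q x w : ev (fun l => q l ^ x) w = ev q w ^ x.
Proof. by elim: w => [|l w IHw] /=; rewrite ?conj1g // IHw conjMg. Qed.

Definition basic q :=
  [/\ q La * q La = 1, q Lb * q Lb = 1, q Lc * q Lc = 1, q Ld * q Ld = 1
    & q Lb * q Lc * q Ld = 1].

Definition tuple4 (x y z t : Q) : letter -> Q :=
  fun l => match l with La => x | Lb => y | Lc => z | Ld => t end.

Lemma mulg_invol (x : Q) : x * x = 1 -> x^-1 = x.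
Proof. exact: mulg1_eq. Qed.

Lemma commuteJ (x y z : Q) : commute x y -> commute (x ^ z) (y ^ z).
Proof. by rewrite /commute -!conjMg => ->. Qed.

Lemma commute_sqr (x y : Q) :
  x * x = 1 -> y * y = 1 -> (x * y) ^+ 2 = 1 -> commute x y.
Proof.
by move=> xx yy /mulg1_eq; rewrite invgM (mulg_invol xx) (mulg_invol yy).
Qed.

Section Dihedral.
Variables x y : Q.
Hypotheses (xx : x * x = 1) (yy : y * y = 1) (xy4 : (x * y) ^+ 4 = 1).

Definition in_dihedral (g : Q) := exists k (e : bool), g = (x * y) ^+ k * x ^+ e.

(** [x] inverts [x * y], whose inverse is its cube; this keeps the normal form free of inverses. *)
Lemma dihedral_conj k : x * (x * y) ^+ k = (x * y) ^+ (3 * k) * x.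
Proof.
have -> : x * (x * y) ^+ k = ((x * y) ^+ k) ^ x * x.
  by rewrite conjgE (mulg_invol xx) -!mulgA xx mulg1.
congr (_ * _); rewrite conjXg expgnA; congr (_ ^+ _).
have /mulg1_eq <- : (x * y) * (x * y) ^+ 3 = 1 by rewrite -expgS.
by rewrite conjgE invgM !(mulg_invol xx, mulg_invol yy) !mulgA xx mul1g.
Qed.

Lemma dihedral_braid : x * y * x * y = y * x * y * x.
Proof.
have /mulg1_eq : (x * y * x * y) * (x * y * x * y) = 1.
  by rewrite -[RHS]xy4 !expgSS expg1 !mulgA.
by rewrite !invgM (mulg_invol xx) (mulg_invol yy) !mulgA.
Qed.

Lemma in_dihedral1 : in_dihedral 1.
Proof. by exists 0, false; rewrite mulg1. Qed.

Lemma in_dihedralMx g : in_dihedral g -> in_dihedral (x * g).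
Proof.
case=> k [e ->]; exists (3 * k)%N, (~~ e); rewrite mulgA dihedral_conj -mulgA.
by congr (_ * _); case: e; rewrite /= ?expg1 ?expg0 ?mulg1.
Qed.

Lemma in_dihedralMy g : in_dihedral g -> in_dihedral (y * g).
Proof.
move=> dg; have -> : y * g = x * (x * y * g) by rewrite !mulgA xx mul1g.
apply: in_dihedralMx; case: dg => k [e ->]; exists k.+1, e.
by rewrite expgS !mulgA.
Qed.

Lemma dihedral_expg4 g : in_dihedral g -> g ^+ 4 = 1.
Proof.
case=> k [[] ->]; rewrite ?mulg1; last by rewrite -expgnA mulnC expgnA xy4 expg1n.
suff gg : (x * y) ^+ k * x ^+ true * ((x * y) ^+ k * x ^+ true) = 1.
  by rewrite (expgnA _ 2 2) [X in X ^+ 2]expg2 gg expg1n.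
rewrite expg1 -!mulgA [x * (_ * _)]mulgA dihedral_conj !mulgA -expgnDr.
by rewrite -mulgA xx mulg1 -mulSn expgnA xy4 expg1n.
Qed.

Lemma in_dihedral_ev q w :
  (forall l, q l \in [:: 1; x; y; x * y * x]) -> in_dihedral (ev q w).
Proof.
move=> qxy; elim: w => [|l w IHw] /=; first exact: in_dihedral1.
have := qxy l; rewrite !inE => /or4P[] /eqP->; rewrite ?mul1g -?mulgA //.
- exact: in_dihedralMx.
- exact: in_dihedralMy.
- by apply/in_dihedralMx/in_dihedralMy/in_dihedralMx.
Qed.

End Dihedral.
End Eval.

(** * A presentation of the level quotients *)

Section Presentation.
Variable Q : groupType.
Implicit Types (q : letter -> Q) (w : letterword).

Definition sub_letter (l : letter) : letterword :=
  match l with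
  | La => [:: La; Lc; La] | Lb => [:: Ld] | Lc => [:: Lb] | Ld => [:: Lc]
  end.

Definition sub_word (w : letterword) : letterword :=
  flatten (map sub_letter w).

Definition sub_tuple q : letter -> Q :=
  tuple4 (q La * q Lc * q La) (q Ld) (q Lb) (q Lc).

Lemma ev_sub q w : ev q (sub_word w) = ev (sub_tuple q) w.
Proof.
elim: w => //= l w IHw; rewrite ev_cat IHw.
by case: l; rewrite /= ?mulg1 ?mulgA.
Qed.

(** * Recovering a word from its two sections *)

Section Identity.
Variable q : letter -> Q.
Hypothesis qB : basic q.
Local Notation a := (q La).
Local Notation b := (q Lb).
Local Notation c := (q Lc).
Local Notation d := (q Ld).
Local Notation t := (a * c * a).

Let a2 : a * a = 1. Proof. by case: qB. Qed.
Let b2 : b * b = 1. Proof. by case: qB. Qed.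
Let c2 : c * c = 1. Proof. by case: qB. Qed.
Let d2 : d * d = 1. Proof. by case: qB. Qed.
Let aV : a^-1 = a. Proof. exact: mulg_invol. Qed.
Let bV : b^-1 = b. Proof. exact: mulg_invol. Qed.
Let cV : c^-1 = c. Proof. exact: mulg_invol. Qed.
Let dV : d^-1 = d. Proof. exact: mulg_invol. Qed.
Let aK x : x * a * a = x. Proof. by rewrite -mulgA a2 mulg1. Qed.
Let cK x : x * c * c = x. Proof. by rewrite -mulgA c2 mulg1. Qed.

Local Notation e := (d ^ a).

Lemma basic_bE : b = d * c.
Proof.
have /mulg1_eq : b * (c * d) = 1 by rewrite mulgA; case: qB.
by move/(canRL (@invgK Q)); rewrite invgM cV dV.
Qed.

Lemma basic_commute_cd : commute c d.
Proof.
have /mulg1_eq : b * (c * d) = 1 by rewrite mulgA; case: qB.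
by rewrite bV basic_bE.
Qed.

(** In the wreath recursion [dih_tuple] has the same section at the letter 0 as [sub_tuple], so
    dividing one value by the other leaves an element that acts only below the letter 1. *)
Definition dih_tuple := tuple4 (c ^ a) 1 c c.
Definition sub_tuple0 := tuple4 c (d ^ a) (b ^ a) (c ^ a).

Lemma basic_tE : t = c ^ a. Proof. by rewrite conjgE aV mulgA. Qed.

Lemma ev_sub_tuple0 w : ev sub_tuple0 w = ev (sub_tuple q) w ^ a.
Proof.
rewrite -ev_conj; apply: eq_ev; case => //=.
by rewrite basic_tE -conjgM a2 conjg1.
Qed.

Hypothesis u0 : (a * d) ^+ 4 = 1.
Hypothesis u1 : (a * c) ^+ 8 = 1.
Hypothesis v0 : (a * d * a * (c * a * c)) ^+ 4 = 1.

Lemma commute_ed : commute e d.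
Proof.
have e2 : e * e = 1 by rewrite -conjMg d2 conj1g.
apply: commute_sqr => //; rewrite -[RHS]u0 (expgnA _ 2 2) [X in _ = X ^+ 2]expg2.
by rewrite conjgE aV !mulgA.
Qed.

(** By [v0] the product of the involutions [e] and [e ^ (c * a * c)] has square 1, so they commute.
    Conjugation by [a * (c ^ a * c)] turns them into [d ^ (c ^ a * c)] and [e]. *)
Lemma commute_e_far : commute e (d ^ (c ^ a * c)).
Proof.
have e2 : e * e = 1 by rewrite -conjMg d2 conj1g.
have yV : (c * a * c)^-1 = c * a * c by rewrite !invgM aV cV !mulgA.
have : commute e (e ^ (c * a * c)).
  apply: commute_sqr => //; first by rewrite -conjMg e2 conj1g.
  rewrite -[RHS]v0 (expgnA _ 2 2) [X in _ = X ^+ 2]expg2.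
  by rewrite [e ^ (c * a * c)]conjgE yV conjgE aV !mulgA.
move/(commuteJ (a * (c ^ a * c)))/commute_sym.
have -> : e ^ (a * (c ^ a * c)) = d ^ (c ^ a * c) by rewrite !conjgM -(conjgM d) a2 conjg1.
rewrite -!conjgM; have -> : a * (c * a * c * (a * (c ^ a * c))) = a.
  by rewrite [c ^ a]conjgE aV !mulgA !(aK, cK).
by [].
Qed.

Lemma dihedral_tc4 : (c ^ a * c) ^+ 4 = 1.
Proof.
by rewrite -basic_tE -mulgA -[RHS]u1 (expgnA _ 2 4).
Qed.

(** Since [c] commutes with [d], the dihedral group of [c ^ a] and [c] yields at most four
    conjugates of [d]. Two are settled by [u0] and [v0], the others by conjugating with [c ^ a],
    which fixes [e]. *)
Lemma commute_e_d_dih w : commute e (d ^ ev dih_tuple w).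
Proof.
have dc : d ^ c = d by rewrite conjgE -basic_commute_cd cV mulgA c2 mul1g.
have tt : c ^ a * c ^ a = 1 by rewrite -conjMg c2 conj1g.
have et : e ^ (c ^ a) = e by rewrite -conjJg dc.
have e1 : commute e d := commute_ed.
have e2 : commute e (d ^ (c ^ a)) by have := commuteJ (c ^ a) e1; rewrite et.
have e3 := commute_e_far.
have e4 : commute e (d ^ (c ^ a * c * c ^ a)).
  by have := commuteJ (c ^ a) e3; rewrite et -conjgM.
have tctc : c ^ a * c * c ^ a * c = c * c ^ a * c * c ^ a.
  exact: dihedral_braid tt c2 dihedral_tc4.
suff : d ^ ev dih_tuple w \in
    [:: d; d ^ (c ^ a); d ^ (c ^ a * c); d ^ (c ^ a * c * c ^ a)].
  by rewrite !inE => /or4P[] /eqP->.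
elim/last_ind: w => [|w l IHw]; first by rewrite conjg1 inE eqxx.
rewrite -cats1 ev_cat conjgM /= mulg1 !inE.
move: IHw; rewrite !inE => /or4P[] /eqP->; rewrite -?conjgM.
- by case: l => /=; rewrite ?conjg1 ?dc ?eqxx ?orbT.
- by case: l => /=; rewrite ?tt ?mulg1 ?conjg1 ?eqxx ?orbT.
- by case: l => /=; rewrite ?cK ?mulg1 ?eqxx ?orbT // -mulgA c2 mulg1 eqxx orbT.
- case: l => /=; rewrite ?mulg1 ?eqxx ?orbT //.
  + by rewrite -mulgA tt mulg1 eqxx !orbT.
  + by rewrite tctc -!(mulgA c) conjgM dc !mulgA eqxx !orbT.
  + by rewrite tctc -!(mulgA c) conjgM dc !mulgA eqxx !orbT.
Qed.

(** The conjugated element is a product of conjugates of its values on letters, which are 1 or [d].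
    The exponent is arbitrary because conjugators accumulate. *)
Lemma commute_e_sub_dih y w :
  commute e ((ev (sub_tuple q) y * (ev dih_tuple y)^-1) ^ ev dih_tuple w).
Proof.
elim: y w => [|l y IHy] w /=; first by rewrite invg1 mulg1 conj1g; apply: commute1.
set S := ev _ y; set T := ev _ y.
have -> : sub_tuple q l * S * (dih_tuple l * T)^-1 =
    (sub_tuple q l * (dih_tuple l)^-1) * (S * T^-1) ^ (dih_tuple l)^-1.
  by rewrite conjgE invgK invgM !mulgA mulgVK.
have TlV : (dih_tuple l)^-1 = dih_tuple l by case: l; rewrite /= -?conjVg ?invg1 ?cV.
rewrite conjMg -conjgM {2}TlV; apply: commuteM; last exact: IHy (l :: w).
have dcE : b * c = d by rewrite basic_bE -mulgA c2 mulg1.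
case: l {TlV} => /=; rewrite ?basic_tE ?mulgV ?conj1g ?cV ?dcE ?invg1 ?mulg1.
- exact: commute1.
- exact: commute_e_d_dih.
- exact: commute_e_d_dih.
- exact: commute1.
Qed.

(** Up to the leading [a], the product of the first two factors has sections 1 and [w_1 h^-1], and
    the last factor has sections [w_0] and [h], for the same word [h]. In the induction a new letter
    moves into place because [e] commutes with the first two factors together. *)
Lemma ev_section w :
  ev q w = a ^+ odd_a w *
    (ev (sub_tuple q) (section true w) * (ev dih_tuple (section true w))^-1
     * ev sub_tuple0 (section false w)).
Proof.
have comm y : commute e (ev (sub_tuple q) y * (ev dih_tuple y)^-1).
  by have := commute_e_sub_dih y [::]; rewrite conjg1.
have aaK x : a * (a * x) = x by rewrite mulgA a2 mul1g.
have dc : d ^ c = d by rewrite conjgE -basic_commute_cd cV mulgA c2 mul1g.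
have te : commute (c ^ a) e by apply/commuteJ/basic_commute_cd.
have tt : c ^ a * c ^ a = 1 by rewrite -conjMg c2 conj1g.
have tV := mulg_invol tt.
have baE : b ^ a = e * c ^ a by rewrite -conjMg -basic_bE.
have caE : c * a = a * c ^ a by rewrite -conjgC.
have daE : d * a = a * e by rewrite -conjgC.
elim: w => [|l w IHw] /=; first by rewrite invg1 !mulg1.
rewrite IHw; move: (odd_a w) (section true w) (section false w) => p w1 w0 {IHw}.
have := comm w1; rewrite /commute.
have baE' : b * a = a * (e * c ^ a) by rewrite -baE -conjgC.
case: l p => -[] /=; rewrite ?expg1 ?expg0 ?mul1g ?aaK // ?basic_tE ?baE.
all: set S := ev (sub_tuple q) w1; set T := ev dih_tuple w1; set S' := ev _ w0.
all: rewrite ?(invgM (c ^ a)) ?tV ?(invgM c) ?cV.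
all: move: te tt caE daE baE'; move: (c ^ a) e => u v te tt caE daE baE' SV.
all: have uK x : u * (u * x) = x by rewrite mulgA tt mul1g.
all: have ccK x : c * (c * x) = x by rewrite mulgA c2 mul1g.
all: have teK x : u * (v * x) = v * (u * x) by rewrite mulgA te mulgA.
all: have SVK x : S * (T^-1 * (v * x)) = v * (S * (T^-1 * x))
  by rewrite (mulgA S) (mulgA (S * _) v) -SV -!mulgA.
all: rewrite ?mulgA ?baE' ?caE ?daE -?mulgA ?(uK, ccK, teK, SVK) //.
Qed.

Lemma ev_dih_tuple w : commute (c ^ a) c ->
  ev dih_tuple w = (c ^ a) ^+ odd_a w * c ^+ odd_cd w.
Proof.
move=> com; elim: w => [|l w IHw] /=; first by rewrite mulg1.
have tt : c ^ a * c ^ a = 1 by rewrite -conjMg c2 conj1g.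
have comX : c * (c ^ a) ^+ odd_a w = (c ^ a) ^+ odd_a w * c.
  by apply/commuteX/commute_sym.
rewrite {}IHw; case: l => /=; move: tt comX; move: (c ^ a) => u tt comX; rewrite ?mul1g //.
- by case: (odd_a w); rewrite /= mulgA ?tt ?mulg1.
- by rewrite mulgA comX -mulgA; congr (_ * _); case: odd_cd; rewrite /= ?mulg1.
- by rewrite mulgA comX -mulgA; congr (_ * _); case: odd_cd; rewrite /= ?mulg1.
Qed.
End Identity.

(** If [d = 1] then [b = c], so [sub_tuple] and [dih_tuple] agree; as [c ^ a] commutes with [c],
    only parities of the sections matter, and triviality on level 2 kills these. *)
Lemma ev_level2 q w : basic q -> q Ld = 1 -> (q La * q Lb) ^+ 4 = 1 ->
  trivial_on 2 w -> ev q w = 1.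
Proof.
move=> qB d1 ab4 /trivial_onS[/negbTE ow tw].
have [a2 b2 c2 d2 _] := qB.
have bc : q Lb = q Lc by rewrite basic_bE // d1 mul1g.
have aV := mulg_invol a2; have cV := mulg_invol c2.
have u0 : (q La * q Ld) ^+ 4 = 1 by rewrite d1 mulg1 !expgSS expg1 !(a2, mulg1).
have u1 : (q La * q Lc) ^+ 8 = 1 by rewrite -bc (expgnA _ 4 2) ab4 expg1n.
have v0 : (q La * q Ld * q La * (q Lc * q La * q Lc)) ^+ 4 = 1.
  rewrite d1 mulg1 a2 mul1g !expgSS expg1.
  by rewrite !mulgA -!(mulgA _ (q Lc) (q Lc)) c2 !mulg1 -!(mulgA _ (q La) (q La)) a2 !mulg1.
have com : commute (q Lc ^ q La) (q Lc).
  apply: commute_sqr => //; first by rewrite -conjMg c2 conj1g.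
  by rewrite conjgE aV -[RHS]ab4 bc !expgSS !expg1 !mulgA.
have cdE x : odd_cd (section x w) = false.
  by rewrite odd_cd_section; have /trivial_onS[/negbTE] := tw (~~ x).
have aE x : odd_a (section x w) = false.
  by have /trivial_onS[/negbTE] := tw x.
have SE v : ev (sub_tuple q) v = ev (dih_tuple q) v.
  by apply: eq_ev; case; rewrite //= ?basic_tE.
rewrite ev_section // ow ev_sub_tuple0 // !SE !ev_dih_tuple // !cdE !aE.
by rewrite !expg0 !(mulg1, invg1, conj1g).
Qed.

(* The relators of the quotient acting on level k + 3 are the fourth powers of
   [root k i] for i < 2 k + 3; larger indices only repeat the last root. *)
Fixpoint root (k i : nat) : letterword :=
  match k, i with
  | 0, 0 => [:: La; Ld]
  | 0, 1 => [:: La; Lc]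
  | 0, _ => [:: La; Lc; La; Ld]
  | _.+1, 0 => [:: La; Ld]
  | _.+1, 1 => [:: La; Ld; La; Lc; La; Lc]
  | k'.+1, i'.+2 => sub_word (root k' i')
  end.

Definition relations k q := basic q /\ forall i, ev q (root k i) ^+ 4 = 1.

Lemma basic_sub_tuple q : basic q -> basic (sub_tuple q).
Proof.
move=> qB; have [a2 b2 c2 d2 _] := qB; split=> //=.
- by rewrite basic_tE // -conjMg c2 conj1g.
- by rewrite -(mulgA (q Ld)) basic_bE // -(mulgA (q Ld)) c2 mulg1 d2.
Qed.

Lemma relations_sub k q : relations k.+1 q -> relations k (sub_tuple q).
Proof.
case=> qB r; split=> [|i]; first exact: basic_sub_tuple.
by rewrite -ev_sub; apply: (r i.+2).
Qed.

(** Here [c] commutes with [c ^ a] and [d], so powers of [c] split off from [sub_tuple q]. What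
    remains is [q2], to which [ev_level2] applies because of the fourth power of [acad]. *)
Lemma ev_level3 q w : relations 0 q -> trivial_on 3 w -> ev q w = 1.
Proof.
case=> qB r /trivial_onS[/negbTE ow tw].
have [a2 b2 c2 d2 _] := qB.
have aV := mulg_invol a2; have cV := mulg_invol c2; have dV := mulg_invol d2.
have u0 : (q La * q Ld) ^+ 4 = 1 by rewrite -[RHS](r 0%N) /= mulg1.
have ac4 : (q La * q Lc) ^+ 4 = 1 by rewrite -[RHS](r 1%N) /= mulg1.
have t0 : (q La * q Lc * q La * q Ld) ^+ 4 = 1.
  by rewrite -[RHS](r 2) /= mulg1 !mulgA.
have u1 : (q La * q Lc) ^+ 8 = 1 by rewrite (expgnA _ 4 2) ac4 expg1n.
have com : commute (q Lc ^ q La) (q Lc).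
  apply: commute_sqr => //; first by rewrite -conjMg c2 conj1g.
  by rewrite conjgE aV -[RHS]ac4 !expgSS !expg1 !mulgA.
have v0 : (q La * q Ld * q La * (q Lc * q La * q Lc)) ^+ 4 = 1.
  have -> : q La * q Ld * q La * (q Lc * q La * q Lc) =
            (q Ld * q La) ^ (q Lc * q La).
    rewrite conjgE invgM aV cV.
    have /= := com; rewrite /commute conjgE aV !mulgA => {}com.
    rewrite -(mulgA (q La) (q Lc) (q Ld)) basic_commute_cd // -!mulgA.
    by congr (_ * (_ * _)); rewrite !mulgA.
  rewrite -conjXg; have -> : q Ld * q La = (q La * q Ld)^-1 by rewrite invgM aV dV.
  by rewrite expVgn u0 invg1 conj1g.
have cdE x : odd_cd (section x w) = false.
  by rewrite odd_cd_section; have /trivial_onS[/negbTE] := tw (~~ x).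
have aE x : odd_a (section x w) = false.
  by have /trivial_onS[/negbTE] := tw x.
have cd := basic_commute_cd qB.
pose q2 := tuple4 (q Lc ^ q La) (q Ld) (q Ld) 1.
have q2B : basic q2.
  by split; rewrite /= ?mulg1 // -conjMg c2 conj1g.
have comX v : commute (q Lc) (ev q2 v).
  elim: v => [|l v IHv] /=; first exact: commute1.
  apply: commuteM IHv; by case: l => //=; apply: commute1.
have SE v : ev (sub_tuple q) v = ev q2 v * q Lc ^+ odd_cd v.
  elim: v => [|l v IHv] /=; first by rewrite mulg1.
  have XE : q Lc * q Lc ^+ odd_cd v = q Lc ^+ (~~ odd_cd v).
    by case: odd_cd; rewrite /= ?mulg1.
  rewrite IHv; case: l => /=; rewrite ?basic_tE ?mulgA ?mul1g //.
  - by rewrite basic_bE // -(mulgA (q Ld)) comX -mulgA -mulgA XE mulgA.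
  - by rewrite comX -mulgA XE.
have S1 x : ev (sub_tuple q) (section x w) = 1.
  rewrite SE cdE mulg1; apply: ev_level2 (tw x) => //=.
  by rewrite -basic_tE.
rewrite ev_section // ow ev_sub_tuple0 // !S1 ev_dih_tuple // cdE aE.
by rewrite !expg0 !(mulg1, invg1, conj1g).
Qed.

Lemma presentation k q w : relations k q -> trivial_on k.+3 w -> ev q w = 1.
Proof.
elim: k q w => [|k IHk] q w; first exact: ev_level3.
move=> rq tw; have [qB r] := rq; move/trivial_onS: (tw) => [/negbTE ow tws].
have rS := relations_sub rq; have [a2 b2 c2 d2 _] := qB.
have u0 : (q La * q Ld) ^+ 4 = 1 by rewrite -[RHS](r 0%N) /= mulg1.
have u1 : (q La * q Lc) ^+ 8 = 1.
  have := r 2; rewrite (_ : root k.+1 2 = sub_word [:: La; Ld]); last by case: (k).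
  by rewrite (expgnA _ 2 4) expg2 /= mulg1 !mulgA.
have v0 : (q La * q Ld * q La * (q Lc * q La * q Lc)) ^+ 4 = 1.
  by rewrite -[RHS](r 1%N) /= mulg1 !mulgA.
(* The values of [dih_tuple] lie in a dihedral group of exponent dividing 4, where the fourth powers
   of all roots are trivial. *)
have tt : q Lc ^ q La * q Lc ^ q La = 1 by rewrite -conjMg c2 conj1g.
have T1 : ev (dih_tuple q) (section true w) = 1.
  apply: (IHk _ _ _ (tws true)); split; first by split; rewrite //= mul1g.
  move=> i; apply: (dihedral_expg4 tt c2 (dihedral_tc4 qB u1)).
  apply: in_dihedral_ev => //; first exact: dihedral_tc4 qB u1.
  by case; rewrite /= !inE eqxx ?orbT.
rewrite ev_section // ow ev_sub_tuple0 // T1 !(IHk _ _ rS) //.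
by rewrite !expg0 !(mulg1, invg1, conj1g).
Qed.

End Presentation.

(** * Central extensions *)

Section CentralExtension.
Variables (A : zmodType) (G : groupType).

Definition cocycle (alpha : G -> G -> A) :=
  forall g h k, (alpha g h + alpha (g * h)%g k = alpha h k + alpha g (h * k)%g)%R.

Variable alpha : G -> G -> A.
Hypothesis alphaP : cocycle alpha.

Definition cext of cocycle alpha := (A * G)%type.
Local Notation E := (cext alphaP).

HB.instance Definition _ := Choice.on E.

(** Cocycles are not normalized, hence the correction by [alpha 1 1] here and in [central]. *)
Definition cext_one : E := ((- alpha 1 1)%R, 1).
Definition cext_mul (x y : E)  : E :=
  ((x.1 + y.1 + alpha x.2 y.2)%R, x.2 * y.2).
Definition cext_inv (x : E) : E :=
  ((- x.1 - alpha x.2^-1 x.2 - alpha 1 1)%R, x.2^-1).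

Lemma cocycle1g g : alpha 1 g = alpha 1 1.
Proof. by have := alphaP 1 1 g; rewrite !mul1g => /addIr. Qed.

Lemma cocycleg1 g : alpha g 1 = alpha 1 1.
Proof. by have := alphaP g 1 1; rewrite !mulg1 => /addIr. Qed.

Lemma cocycleV g : alpha g g^-1 = alpha g^-1 g.
Proof.
by have := alphaP g g^-1 g; rewrite mulgV mulVg cocycle1g cocycleg1 => /addIr.
Qed.

Lemma cext_mulA : associative cext_mul.
Proof.
move=> [x g] [y h] [z k]; rewrite /cext_mul /= mulgA; congr pair.
rewrite -!addrA; congr (_ + (_ + _))%R.
by rewrite -alphaP addrCA.
Qed.

Lemma cext_mul1g : left_id cext_one cext_mul.
Proof.
by case=> x g; rewrite /cext_mul /= mul1g cocycle1g addrAC addNr add0r.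
Qed.

Lemma cext_mulg1 : right_id cext_one cext_mul.
Proof. by case=> x g; rewrite /cext_mul /= mulg1 cocycleg1 subrK. Qed.

Lemma cext_mulVg : left_inverse cext_one cext_inv cext_mul.
Proof.
case=> x g; rewrite /cext_mul /= mulVg; congr pair.
by rewrite -addrA -opprD addrAC addNr add0r.
Qed.

Lemma cext_mulgV : right_inverse cext_one cext_inv cext_mul.
Proof.
case=> x g; rewrite /cext_mul /= mulgV cocycleV; congr pair.
by rewrite !addrA subrr add0r addrAC addNr add0r.
Qed.

HB.instance Definition _ := isGroup.Build E cext_mulA
  cext_mul1g cext_mulg1 cext_mulVg cext_mulgV.

Definition central (x : A) : E := ((x - alpha 1 1)%R, 1).

Lemma cext_mulE (x y : E) :
  x * y = ((x.1 + y.1 + alpha x.2 y.2)%R, x.2 * y.2) :> E.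
Proof. by []. Qed.

Lemma cext_oneE : 1 = ((- alpha 1 1)%R, 1) :> E.
Proof. by []. Qed.

Lemma central_mul (x : A) (y : E) : central x * y = ((x + y.1)%R, y.2) :> E.
Proof.
by case: y => y g; rewrite cext_mulE /= mul1g cocycle1g addrAC subrK.
Qed.

Lemma mul_central (x : A) (y : E) : y * central x = ((x + y.1)%R, y.2) :> E.
Proof.
by case: y => y g; rewrite cext_mulE /= mulg1 cocycleg1 -addrA subrK addrC.
Qed.

Lemma central_commute (x : A) (y : E) : commute (central x) y.
Proof. by rewrite /commute central_mul mul_central. Qed.

Lemma centralD (x y : A) : central (x + y)%R = central x * central y.
Proof. by rewrite central_mul /= addrA. Qed.

Lemma central0 : central 0 = 1.
Proof. by rewrite /central sub0r. Qed.

Lemma central_inj : injective central.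
Proof. by move=> x y [/addIr]. Qed.

Lemma ev_cext2 (q : letter -> E) w : (ev q w).2 = ev (fun l => (q l).2) w.
Proof. by elim: w => //= l w ->. Qed.

Lemma ev_cext_shift (x : letter -> A) (g : letter -> G) w :
  (ev (fun l => (x l, g l) : E) w).1 =
  ((ev (fun l => (0%R, g l) : E) w).1 + \sum_(l <- w) x l)%R.
Proof.
elim: w => [|l w IHw] /=; first by rewrite big_nil addr0.
by rewrite IHw !ev_cext2 /= big_cons add0r addrCA addrAC.
Qed.

End CentralExtension.

(** * Words in the Grigorchuk group *)

Section GrigorchukLetters.

Definition grig_aut (l : letter) : treeAut :=
  match l with
  | La => grig_a | Lb => grig_b | Lc => grig_c | Ld => grig_d
  end.

Lemma grig_aut_gen l : grig_aut l \in generated [:: grig_a; grig_b; grig_c; grig_d].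
Proof. by apply/asboolP => N; apply; case: l; rewrite !inE eqxx ?orbT. Qed.

Definition grig_letter (l : letter) : grigorchuk := GeneratedGroup (grig_aut_gen l).

Lemma genval_ev w x : genval (ev grig_letter w) x = act_word w x.
Proof. by elim: w => //= l w <-; case: l. Qed.

Lemma ev_rev (Q : groupType) (q : letter -> Q) w :
  (forall l, q l * q l = 1) -> ev q (rev w) = (ev q w)^-1.
Proof.
move=> q2; elim: w => [|l w IHw] /=; first by rewrite invg1.
by rewrite rev_cons -cats1 ev_cat IHw invgM /= mulg1 (mulg_invol (q2 l)).
Qed.

Lemma grig_letter2 l : grig_letter l * grig_letter l = 1.
Proof.
apply: val_inj; apply: treeAut_eqP => x /=.
have [bK cK dK] := grig_bcd_involutive x.
by case: l => //=; case: x {bK cK dK} => //= y x; rewrite negbK.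
Qed.

Definition is_grig_ev : {pred treeAut} :=
  fun g => `[< exists w, g = ev grig_aut w >].

Lemma is_grig_ev_group : group_closed is_grig_ev.
Proof.
have aut2 l : grig_aut l * grig_aut l = 1.
  by have /(congr1 val) := grig_letter2 l.
split=> [|g h /asboolP[u ->] /asboolP[v ->]]; apply/asboolP; first by exists [::].
by exists (u ++ rev v); rewrite ev_cat ev_rev.
Qed.

Lemma grig_ev_surj (g : grigorchuk) : exists w, ev grig_letter w = g.
Proof.
have [_ gM] := is_grig_ev_group; have gV := group_closedV is_grig_ev_group.
have gM' := group_closedM is_grig_ev_group.
(* Values of words form a subgroup that contains the generators, so it contains every element of
   [generated]. *)
pose N : groupClosed treeAut := HB.pack is_grig_ev
  (isMulClosed.Build _ is_grig_ev gM')
  (isMul1Closed.Build _ is_grig_ev (proj1 is_grig_ev_group))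
  (isInvClosed.Build _ is_grig_ev gV).
have /asboolP/(_ N) := genvalP g.
case/(_ _)/asboolP => [x|w wE].
  rewrite !inE => /or4P[] /eqP->; apply/asboolP.
  - by exists [:: La]; rewrite /= mulg1.
  - by exists [:: Lb]; rewrite /= mulg1.
  - by exists [:: Lc]; rewrite /= mulg1.
  - by exists [:: Ld]; rewrite /= mulg1.
exists w; apply: val_inj; rewrite /= wE.
by elim: w {wE} => //= l w <-.
Qed.

Variable n : nat.
Local Notation Gn := (grigorchuk_quotient n).

Definition quo_letter (l : letter) : Gn := (\pi_Gn (grig_letter l))%qT.

Lemma ev_quo_letter w : ev quo_letter w = (\pi_Gn (ev grig_letter w))%qT.
Proof.
elim: w => //= l w ->.
by rewrite /quo_letter (pi_quotient_mul (@level_stabilizer_normal n)).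
Qed.

Lemma ev_quo_surj (g : Gn) : exists w, ev quo_letter w = g.
Proof.
have [w wE] := grig_ev_surj (repr g).
by exists w; rewrite ev_quo_letter wE reprK.
Qed.

Lemma ev_quo_letterP w : ev quo_letter w = 1 <-> trivial_on n w.
Proof.
have st h : h \in level_stabilizer n <-> h^-1 \in level_stabilizer n.
  by rewrite gpredV.
split=> [|tw].
  rewrite ev_quo_letter => /(quotient_eqE (@level_stabilizer_normal n)).
  rewrite mulg1 -st => /level_stabilizerP tw x sx.
  by rewrite -genval_ev tw.
rewrite ev_quo_letter; apply/(quotient_eqE (@level_stabilizer_normal n)).
rewrite mulg1 -st; apply/level_stabilizerP => x sx.
by rewrite genval_ev tw.
Qed.

End GrigorchukLetters.

(** * Invariants of relators *)

Definition word4 (w : letterword) : letterword := w ++ w ++ w ++ w.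

Lemma ev_word4 (Q : groupType) (q : letter -> Q) w : ev q (word4 w) = ev q w ^+ 4.
Proof. by rewrite /word4 !ev_cat !expgSS expg1. Qed.

Lemma bool_addrr (x : bool) : (x + x = 0)%R.
Proof. by case: x. Qed.

Lemma bool_oppr (x : bool) : (- x = x)%R.
Proof. by case: x. Qed.

Lemma sub_word_cat u v : sub_word (u ++ v) = sub_word u ++ sub_word v.
Proof. by rewrite /sub_word map_cat flatten_cat. Qed.

Lemma odd_a_sub w : odd_a (sub_word w) = false.
Proof.
elim: w => //= l w IHw; rewrite odd_a_cat IHw.
by case: l.
Qed.

Lemma section_true_sub w : section true (sub_word w) = w.
Proof.
elim: w => //= l w IHw; rewrite section_cat IHw odd_a_sub.
by case: l.
Qed.

(** All values lie in the group of [a] and [d], which is dihedral of exponent dividing 4 as soon as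
    [(ad)^4 = 1]. *)
Lemma ev_section_false_sub (Q : groupType) (q : letter -> Q) w :
  ev q (section false (sub_word w)) = ev (tuple4 (q Ld) 1 (q La) (q La)) w.
Proof.
elim: w => //= l w IHw; rewrite section_cat ev_cat IHw odd_a_sub.
by case: l; rewrite /= ?mulg1.
Qed.

Lemma section_word4 x w : odd_a w = false ->
  section x (word4 w) = word4 (section x w).
Proof. by move=> ow; rewrite /word4 !section_cat !odd_a_cat ow !addbF. Qed.

Lemma sub_word4 w : sub_word (word4 w) = word4 (sub_word w).
Proof. by rewrite /word4 !sub_word_cat. Qed.

Lemma trivial_on_square n l : trivial_on n [:: l; l].
Proof.
apply/ev_quo_letterP; rewrite /= mulg1.
by have := congr1 (\pi_(grigorchuk_quotient n))%qT (grig_letter2 l);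
  rewrite (pi_quotient_mul (@level_stabilizer_normal n)).
Qed.

Lemma act_bcd x : act_word [:: Lb; Lc; Ld] x = x.
Proof.
have aK : involutive grig_a_fun by case=> //= y v; rewrite negbK.
suff : [/\ grig_b_fun (grig_c_fun (grig_d_fun x)) = x,
           grig_c_fun (grig_d_fun (grig_b_fun x)) = x
         & grig_d_fun (grig_b_fun (grig_c_fun x)) = x] by case.
by elim: x => // -[] x [IH1 IH2 IH3] /=; rewrite ?aK ?IH1 ?IH2 ?IH3.
Qed.

Lemma quo_letter_basic n : basic (quo_letter n).
Proof.
have sq l : quo_letter n l * quo_letter n l = 1.
  by have /ev_quo_letterP := @trivial_on_square n l; rewrite /= mulg1.
split=> //.
have : trivial_on n [:: Lb; Lc; Ld] by move=> x _; apply: act_bcd.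
by move/ev_quo_letterP; rewrite /= mulg1 mulgA.
Qed.

Definition letter_code (l : letter) : nat :=
  match l with La => 0 | Lb => 1 | Lc => 2 | Ld => 3 end.

(** Both sections of [(ad)^4] and of [(adacac)^4] reduce to the empty word in this way, which makes
    these relators checkable by computation on all levels at once. *)
Fixpoint cancel_word (w : letterword) : letterword :=
  if w is l :: w' then
    if cancel_word w' is l' :: v then
      if letter_code l == letter_code l' then v else l :: l' :: v
    else [:: l]
  else [::].

Lemma ev_cancel (Q : groupType) (q : letter -> Q) w :
  (forall l, q l * q l = 1) -> ev q (cancel_word w) = ev q w.
Proof.
move=> q2; elim: w => //= l w <-; case: cancel_word => [|l' v] //=.
case: eqP => //= ll'; have <- : l = l' by case: l l' ll' => -[].
by rewrite mulgA q2 mul1g.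
Qed.

Lemma quo_letter2 n l : quo_letter n l * quo_letter n l = 1.
Proof.
by have /ev_quo_letterP := @trivial_on_square n l; rewrite /= mulg1.
Qed.

Lemma trivial_on_cancel n w : trivial_on n (cancel_word w) -> trivial_on n w.
Proof.
move/ev_quo_letterP; rewrite (ev_cancel _ (@quo_letter2 n)).
by move=> tw; apply/ev_quo_letterP.
Qed.

Lemma trivial_on_ad n : trivial_on n (word4 [:: La; Ld]).
Proof.
case: n => [|n]; first by move=> x /size0nil->.
by apply/trivial_onS; split=> // -[]; apply: trivial_on_cancel.
Qed.

Lemma trivial_on_adacac n : trivial_on n (word4 [:: La; Ld; La; Lc; La; Lc]).
Proof.
case: n => [|n]; first by move=> x /size0nil->.
by apply/trivial_onS; split=> // -[]; apply: trivial_on_cancel.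
Qed.

Lemma ev_ad_expg4 (Q : groupType) (q : letter -> Q) w :
  q La * q La = 1 -> q Ld * q Ld = 1 -> (q La * q Ld) ^+ 4 = 1 ->
  ev q (section false (sub_word w)) ^+ 4 = 1.
Proof.
move=> a2 d2 ad4; rewrite ev_section_false_sub.
apply: (dihedral_expg4 a2 d2 ad4); apply: in_dihedral_ev => // -[];
by rewrite /= !inE eqxx ?orbT.
Qed.

(** A substituted relator has the previous relator as one section and a fourth power in the dihedral
    group of [a] and [d] as the other. *)
Lemma trivial_on_root k i : trivial_on k.+3 (word4 (root k i)).
Proof.
elim: k i => [|k IHk] i.
  by case: i => [|[|i]] [|[] [|[] [|[] [|]]]].
case: i => [|[|i]]; [exact: trivial_on_ad | exact: trivial_on_adacac|].
apply/trivial_onS; rewrite /= -sub_word4; split; first by rewrite odd_a_sub.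
case; first by rewrite section_true_sub.
rewrite sub_word4 section_word4 ?odd_a_sub //; apply/ev_quo_letterP.
have [a2 _ _ d2 _] := quo_letter_basic k.+3.
rewrite ev_word4 ev_ad_expg4 //.
by have /ev_quo_letterP := @trivial_on_ad k.+3; rewrite ev_word4 /= mulg1.
Qed.

(** On words that are trivial on level [n], this single identity expresses both additivity and
    invariance under conjugation, without inverses; addition on [bool] is exclusive or. *)
Definition invariant (n : nat) (f : letterword -> bool) :=
  forall p w r, trivial_on n w -> trivial_on n (p ++ r) ->
  (f (p ++ w ++ r) = f w + f (p ++ r))%R.

Definition basic_invariant (n : nat) (f : letterword -> bool) :=
  [/\ invariant n f, forall l, f [:: l; l] = false & f [:: Lb; Lc; Ld] = false].

Lemma invariant_le m n f : m <= n -> invariant m f -> invariant n f.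
Proof.
by move=> mn fP p w r /(trivial_on_le mn) tw /(trivial_on_le mn); apply: fP.
Qed.

Lemma trivial_on_nil n : trivial_on n [::].
Proof. by []. Qed.

Lemma invariant_nil n f : invariant n f -> f [::] = false.
Proof.
move=> /(_ [::] [::] [::] (@trivial_on_nil n) (@trivial_on_nil n)) /=.
by case: (f _).
Qed.

Lemma invariant_cat n f u v : invariant n f ->
  trivial_on n u -> trivial_on n v -> (f (u ++ v) = f u + f v)%R.
Proof. by move=> fP tu tv; rewrite (fP [::] u v). Qed.

Definition lift_invariant (f : letterword -> bool) : letterword -> bool :=
  fun w => (f (section false w) + f (section true w))%R.

(** If [r] has an odd number of letters [a], the two sections of [w] swap places, which their sum
    does not notice. *)
Lemma lift_invariantP n f : invariant n f -> invariant n.+1 (lift_invariant f).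
Proof.
move=> fP p w r /trivial_onS[/negbTE ow tw] /trivial_onS[opr tpr].
rewrite /lift_invariant !section_cat odd_a_cat ow /=.
have step x : (f (section (x (+) odd_a r) p ++ section (x (+) odd_a r) w ++ section x r)
  = f (section (x (+) odd_a r) w) + f (section (x (+) odd_a r) p ++ section x r))%R.
  by rewrite fP // -section_cat.
rewrite (step false) (step true); case: (odd_a r) => /=.
  by rewrite addrACA [(f (section true w) + _)%R]addrC.
by rewrite addrACA.
Qed.

Lemma lift_basic_invariant n f :
  basic_invariant n f -> basic_invariant n.+1 (lift_invariant f).
Proof.
case=> fP f2 fb; split; first exact: lift_invariantP.
  by case; rewrite /lift_invariant /= ?f2 ?(invariant_nil fP).
rewrite /lift_invariant /= f2.
have t2 l : trivial_on n [:: l; l] by apply: trivial_on_square.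
have tcdb : trivial_on n [:: Lc; Ld; Lb].
  apply/ev_quo_letterP; have [_ _ _ _] := quo_letter_basic n.
  by rewrite -mulgA => /mulg1_eq cdE; rewrite /= mulg1 mulgA -cdE mulVg.
have tbcd : trivial_on n [:: Lb; Lc; Ld] by move=> x _; apply: act_bcd.
(* [b(cdb)b] and [(bcd)(bb)] are the same word; evaluating it both ways shows that [cdb] has the
   value of [bcd]. *)
have := fP [:: Lb] [:: Lc; Ld; Lb] [:: Lb] tcdb (t2 _).
rewrite (fP [::] [:: Lb; Lc; Ld] [:: Lb; Lb] tbcd (t2 _)) /= fb f2.
by case: (f _).
Qed.

(** * Invariants from finite central extensions *)

Section Machine.
Variables (T : finType) (step : letter -> T -> T) (out : letter -> T -> bool).

Fixpoint run (w : letterword) (x : T) : T :=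
  if w is l :: w' then run w' (step l x) else x.

Fixpoint output (w : letterword) (x : T) : bool :=
  if w is l :: w' then (out l x + output w' (step l x))%R else false.

Lemma output_cat u v x : output (u ++ v) x = (output u x + output v (run u x))%R.
Proof. by elim: u x => [|l u IHu] x /=; rewrite ?add0r // IHu addrA. Qed.

Variable x0 : T.

Definition acts_centrally (w : letterword) (x : T) : bool :=
  (run w x == x) && (output w x == output w x0).

Definition basic_words : seq letterword :=
  [:: [:: La; La]; [:: Lb; Lb]; [:: Lc; Lc]; [:: Ld; Ld]; [:: Lb; Lc; Ld]].

Variable k : nat.
Hypothesis basic_central : forall x, all (acts_centrally^~ x) basic_words.
Hypothesis root_central : forall i x, acts_centrally (word4 (root k i)) x.

(** Two copies of the machine run in parallel and the bit adds their outputs. A word that fixes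
    every state with constant output thus acts trivially, even if that output is 1. *)
Let state := (T * T * bool)%type.

Definition machine_fun (l : letter) (s : state) : state :=
  let: (x, y, e) := s in (step l x, step l y, (e + (out l x + out l y))%R).

Lemma foldl_machine_fun w x y e :
  foldl (fun s l => machine_fun l s) (x, y, e) w =
  (run w x, run w y, (e + (output w x + output w y))%R).
Proof.
elim: w x y e => [|l w IHw] x y e /=; first by rewrite !addr0.
by rewrite IHw -addrA [X in (_ + X)%R]addrACA.
Qed.

Lemma central_word_fix w : (forall x, acts_centrally w x) ->
  forall s, foldl (fun s l => machine_fun l s) s w = s.
Proof.
move=> wc [[x y] e].
rewrite foldl_machine_fun.
have /andP[/eqP-> /eqP->] := wc x; have /andP[/eqP-> /eqP->] := wc y.
by rewrite bool_addrr addr0.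
Qed.

Lemma machine_funK l : involutive (machine_fun l).
Proof.
move=> s; have /= := @central_word_fix [:: l; l] _ s; apply => x.
by have /and5P[] := basic_central x; case: l.
Qed.

Definition machine_perm l : {perm state} := perm (can_inj (machine_funK l)).

Lemma ev_machine_perm w s :
  (ev machine_perm w) s = foldl (fun s l => machine_fun l s) s w.
Proof. by elim: w s => [|l w IHw] s /=; rewrite ?perm1 // permM IHw permE. Qed.

Lemma machine_relations : relations k machine_perm.
Proof.
have rel w : (forall x, acts_centrally w x) -> ev machine_perm w = 1.
  by move=> wc; apply/permP => s; rewrite ev_machine_perm central_word_fix // perm1.
split=> [|i]; last by rewrite -ev_word4; apply: rel.
have sq l : machine_perm l * machine_perm l = 1.
  rewrite -[RHS](@rel [:: l; l]) /= ?mulg1 // => x.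
  by have /and5P[] := basic_central x; case: l.
split=> //; rewrite -[RHS](@rel [:: Lb; Lc; Ld]) /= ?mulg1 ?mulgA // => x.
by have /and5P[_ _ _ _ /andP[]] := basic_central x.
Qed.

(** By [presentation] the word acts trivially on doubled states; starting the second copy at [x0]
    compares the two outputs. *)
Lemma machine_trivial w x : trivial_on k.+3 w -> acts_centrally w x.
Proof.
move=> /(presentation machine_relations) wE.
have := ev_machine_perm w (x, x0, false); rewrite wE perm1.
rewrite foldl_machine_fun.
case=> xE _ oE; rewrite /acts_centrally -xE eqxx; apply/eqP.
by move: oE; rewrite /= add0r; do 2! case: (output _ _).
Qed.

Lemma machine_invariant : invariant k.+3 (output^~ x0).
Proof.
move=> p w r tw tr; rewrite !output_cat.
have /andP[/eqP-> /eqP->] := machine_trivial (run p x0) tw.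
by rewrite addrCA.
Qed.

End Machine.

(* The letters a and c act on the first j levels of the binary tree like the
   generators a and (a, c) of an infinite dihedral group; the output records
   the action on the next level, where (a c)^(2^j) is not trivial. *)
Inductive dihedral_role := Rid | Rswap | Rcarry.

Definition dihedral2_step (r : letter -> dihedral_role) (l : letter) (s : bool * bool) :=
  let: (x, y) := s in
  match r l with
  | Rid => s | Rswap => (~~ x, y) | Rcarry => if x then s else (x, ~~ y)
  end.

Definition dihedral2_out (r : letter -> dihedral_role) (l : letter) (s : bool * bool) :=
  if r l is Rcarry then s.1 && ~~ s.2 else false.

Definition dihedral3_step (r : letter -> dihedral_role) (l : letter)
    (s : bool * bool * bool) :=
  let: (x, y, z) := s in
  match r l with
  | Rid => s | Rswap => (~~ x, y, z)
  | Rcarry => if x then (if y then s else (x, y, ~~ z)) else (x, ~~ y, z)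
  end.

Definition dihedral3_out (r : letter -> dihedral_role) (l : letter)
    (s : bool * bool * bool) :=
  if r l is Rcarry then s.1.1 && s.1.2 && ~~ s.2 else false.

Definition role_bd (l : letter) :=
  match l with La => Rswap | Lc => Rid | _ => Rcarry end.

Definition role_bc (l : letter) :=
  match l with La => Rswap | Ld => Rid | _ => Rcarry end.

(** On words with an even number of letters [a] the resulting invariant is the lift of [inv_ac4]. As
    a machine it can be checked on level 3, one lower than [lift_invariantP] would give. *)
Definition pair_step (l : letter) (s : bool * (bool * bool) * (bool * bool)) :=
  let: (p, u, v) := s in
  if l is La then (~~ p, u, v) else
  (p, run (dihedral2_step role_bc) (letter_section l p) u,
      run (dihedral2_step role_bc) (letter_section l (~~ p)) v).

Definition pair_out (l : letter) (s : bool * (bool * bool) * (bool * bool)) : bool :=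
  let: (p, u, v) := s in
  (output (dihedral2_step role_bc) (dihedral2_out role_bc) (letter_section l p) u
  + output (dihedral2_step role_bc) (dihedral2_out role_bc) (letter_section l (~~ p)) v)%R.

(* The conjugates of d by the dihedral group generated by a and c modulo
   (a c)^8 sit at the vertices of an octagon; (k0, k1, k2) are the binary digits
   of the current vertex k, and e tells a and c apart.  The output counts the
   pairs of an occurrence of d at an even vertex followed by one at an odd
   vertex at distance 3.  Only the parities n0, n2, n4 of the occurrences
   at vertices 0, 2, 4, each added to the parity at vertex 6, matter. *)
Definition octagon_state :=
  (bool * bool * bool * bool * (bool * bool * bool))%type.

Definition octagon_step (l : letter) (s : octagon_state) : octagon_state :=
  let: (k0, k1, k2, e, (n0, n2, n4)) := s in
  let has_d := match l with Lb | Ld => true | _ => false end in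
  let has_c := match l with Lb | Lc => true | _ => false end in
  if l is La then
    if e then (~~ k0, k1 (+) ~~ k0, k2 (+) (~~ k1 && ~~ k0), ~~ e, (n0, n2, n4))
    else (~~ k0, k1 (+) k0, k2 (+) (k1 && k0), ~~ e, (n0, n2, n4))
  else
    (k0, k1, k2, e (+) has_c,
      if has_d && ~~ k0 then
        (n0 (+) (k1 == k2), n2 (+) k1, n4 (+) k2)
      else (n0, n2, n4)).

Definition octagon_out (l : letter) (s : octagon_state) : bool :=
  let: (k0, k1, k2, e, (n0, n2, n4)) := s in
  if l is (Lb | Ld) then
    if k0 then
      match k1, k2 with
      | false, false => n4
      | true, false => n0
      | false, true => n0 (+) n2
      | true, true => n2 (+) n4
      end
    else false
  else false.

(* A dihedral central extension of the four-group, in which d has order 4. *)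
Definition klein_step (l : letter) (s : bool * bool) :=
  let: (x, y) := s in
  match l with
  | La => s | Lb => (~~ x, y) | Lc => (x, ~~ y) | Ld => (~~ x, ~~ y)
  end.

Definition klein_out (l : letter) (s : bool * bool) :=
  if l is (Lb | Ld) then s.2 else false.

Definition inv_ad :=
  output (dihedral2_step role_bd) (dihedral2_out role_bd) ^~ (false, false).
Definition inv_ac4 :=
  output (dihedral2_step role_bc) (dihedral2_out role_bc) ^~ (false, false).
Definition inv_acad := output pair_step pair_out ^~ (false, (false, false), (false, false)).
Definition inv_ac8 :=
  output (dihedral3_step role_bc) (dihedral3_out role_bc)
  ^~ (false, false, false).
Definition inv_octagon := output octagon_step octagon_out ^~
  (false, false, false, false, (false, false, false)).
Definition inv_klein := output klein_step klein_out ^~ (false, false).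

Lemma inv_ad_basic : basic_invariant 3 inv_ad.
Proof.
split; [apply: machine_invariant => [|i] | by case | by []].
- by case=> -[] [].
- by case: i => [|[|i]]; case=> -[] [].
Qed.

Lemma inv_ac4_basic : basic_invariant 3 inv_ac4.
Proof.
split; [apply: machine_invariant => [|i] | by case | by []].
- by case=> -[] [].
- by case: i => [|[|i]]; case=> -[] [].
Qed.

Lemma inv_acad_basic : basic_invariant 3 inv_acad.
Proof.
split; [apply: machine_invariant => [|i] | by case | by []].
- by case=> -[[] [[] []]] [[] []].
- by case: i => [|[|i]]; case=> -[[] [[] []]] [[] []].
Qed.

Lemma inv_ac8_basic : basic_invariant 4 inv_ac8.
Proof.
split; [apply: machine_invariant => [|i] | by case | by []].
- by case=> -[[] []] [].
- by case: i => [|[|[|[|i]]]]; case=> -[[] []] [].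
Qed.

Lemma inv_octagon_basic : basic_invariant 4 inv_octagon.
Proof.
split; [apply: machine_invariant => [|i] | by case | by []].
- by case=> -[[[[] []] []] []] [[[] []] []].
- by case: i => [|[|[|[|i]]]]; case=> -[[[[] []] []] []] [[[] []] []].
Qed.

(** This invariant is not basic: it takes the value 1 on [dd], which is how it detects the
    commutator of [b] and [c]. *)
Lemma inv_klein_invariant : invariant 3 inv_klein.
Proof.
apply: machine_invariant => [|i].
- by case=> -[] [].
- by case: i => [|[|i]]; case=> -[] [].
Qed.

(** * Independence of the relators *)

Section InvariantExtension.
Variables (n : nat) (f : letterword -> bool).
Hypothesis fP : invariant n f.
Local Notation Gn := (grigorchuk_quotient n).
Local Notation gam := (quo_letter n).

Definition quo_word (g : Gn) : letterword := sval (cid (ev_quo_surj g)).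

Lemma quo_wordK g : ev gam (quo_word g) = g.
Proof. by rewrite /quo_word; case: cid. Qed.

Definition inv_shift (g : Gn) : bool := f (quo_word g^-1%g ++ quo_word g).

(* The shift makes [inv_lift] multiplicative although the words chosen for g
   and g^-1 are unrelated. *)
Definition inv_cocycle (g h : Gn) : bool :=
  (f (quo_word g ++ quo_word h ++ quo_word (g * h)^-1%g) + inv_shift (g * h)%g)%R.

Definition inv_lift (w : letterword) : bool :=
  (f (w ++ quo_word (ev gam w)^-1%g) + inv_shift (ev gam w))%R.

Lemma inv_lift_cat u v :
  inv_lift (u ++ v) =
  (inv_lift u + inv_lift v + inv_cocycle (ev gam u) (ev gam v))%R.
Proof.
rewrite /inv_lift /inv_cocycle !ev_cat.
set g := ev gam u; set h := ev gam v; set z := quo_word (g * h)^-1.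
have zE : ev gam z = (g * h)^-1 by rewrite quo_wordK.
have triv w : ev gam w = 1 -> trivial_on n w by move/ev_quo_letterP.
have zT : trivial_on n (u ++ v ++ z) by apply: triv; rewrite !ev_cat zE mulgA mulgV.
have shT x : trivial_on n (quo_word x^-1%g ++ quo_word x).
  by apply: triv; rewrite ev_cat !quo_wordK mulVg.
have liftT w x : x = ev gam w -> trivial_on n (w ++ quo_word x^-1%g).
  by move=> ->; apply: triv; rewrite ev_cat !quo_wordK mulgV.
have ghT : trivial_on n (quo_word g ++ quo_word h ++ z).
  by apply: triv; rewrite !ev_cat !quo_wordK mulgA mulgV.
have gvT : trivial_on n (quo_word g ++ v ++ z).
  by apply: triv; rewrite !ev_cat zE quo_wordK mulgA mulgV.
have vT : trivial_on n (quo_word g ++ v ++ (quo_word h^-1%g ++ quo_word h) ++ z).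
  by apply: triv; rewrite !ev_cat zE !quo_wordK mulVg mul1g mulgA mulgV.
have uvT : trivial_on n (u ++ v ++ (quo_word h^-1%g ++ quo_word h) ++ z).
  by apply: triv; rewrite !ev_cat zE !quo_wordK mulVg mul1g mulgA mulgV.
(* The same word is evaluated twice: by dropping the trivial words inserted after [u] and [v], and
   by cutting inside them so that [u] and [v] separate. *)
have fX : f (u ++ (quo_word g^-1%g ++ quo_word g) ++ v ++
    (quo_word h^-1%g ++ quo_word h) ++ z) =
    (inv_shift g + (inv_shift h + f (u ++ v ++ z)))%R.
  by rewrite fP // catA fP // -catA.
have fY : f (u ++ (quo_word g^-1%g ++ quo_word g) ++ v ++
    (quo_word h^-1%g ++ quo_word h) ++ z) =
    (f (u ++ quo_word g^-1%g) + (f (v ++ quo_word h^-1%g) +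
      f (quo_word g ++ quo_word h ++ z)))%R.
  rewrite -!catA catA (fP (p := [::])) /=; last 2 first.
  - exact: liftT.
  - by move: vT; rewrite -!catA.
  by rewrite [X in quo_word g ++ X]catA fP //; exact: liftT.
move: fX; rewrite fY -catA.
do 6! case: (f _); do 3! case: (inv_shift _) => //.
Qed.

(** The identity reflects the associativity of concatenation under [inv_lift]. *)
Lemma inv_cocycleP : cocycle inv_cocycle.
Proof.
move=> g h k.
have := inv_lift_cat (quo_word g ++ quo_word h) (quo_word k).
rewrite -catA !inv_lift_cat !ev_cat !quo_wordK.
move: (inv_cocycle (g * h) k) (inv_cocycle g h) (inv_cocycle h k).
move: (inv_cocycle g (h * k)).
by do 4 case; do 3! case: (inv_lift _).
Qed.

Lemma inv_lift_nil : inv_lift [::] = inv_cocycle 1 1.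
Proof.
have := inv_lift_cat [::] [::]; rewrite /=.
by case: (inv_lift _); case: (inv_cocycle _ _).
Qed.

Lemma inv_lift_trivial w : trivial_on n w -> (inv_lift w = f w + inv_cocycle 1%g 1%g)%R.
Proof.
move=> tw; rewrite -inv_lift_nil /inv_lift /=.
have /ev_quo_letterP -> := tw.
have t1 : trivial_on n (quo_word 1^-1%g).
  by apply/ev_quo_letterP; rewrite quo_wordK invg1.
by rewrite (invariant_cat fP tw t1) addrA.
Qed.

Definition inv_ext_letter (l : letter) : cext inv_cocycleP := (inv_lift [:: l], gam l).

Lemma ev_inv_ext w : ev inv_ext_letter w = (inv_lift w, ev gam w).
Proof.
elim: w => [|l w IHw] /=.
  by rewrite inv_lift_nil cext_oneE bool_oppr.
rewrite IHw cext_mulE /= -[in RHS]cat1s inv_lift_cat /= mulg1.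
by [].
Qed.

Lemma ev_inv_ext_trivial w : trivial_on n w ->
  ev inv_ext_letter w = central inv_cocycleP (f w).
Proof.
move=> tw; rewrite ev_inv_ext inv_lift_trivial // /central bool_oppr.
by have /ev_quo_letterP -> := tw.
Qed.

Lemma ev_inv_ext_eq1 w : trivial_on n w -> ev inv_ext_letter w = 1 -> f w = false.
Proof.
by move=> tw; rewrite ev_inv_ext_trivial // -(central0 inv_cocycleP) => /central_inj.
Qed.

Lemma inv_ext_letter1 w :
  trivial_on n w -> f w = false -> ev inv_ext_letter w = 1.
Proof. by move=> tw fw; rewrite ev_inv_ext_trivial // fw (central0 inv_cocycleP). Qed.

End InvariantExtension.

Section BasicInvariant.
Variables (n : nat) (f : letterword -> bool).
Hypothesis fB : basic_invariant n f.

Let fP : invariant n f. Proof. by case: fB. Qed.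

Lemma inv_ext_letter2 l : inv_ext_letter fP l * inv_ext_letter fP l = 1.
Proof.
have := @inv_ext_letter1 _ _ fP [:: l; l]; rewrite /= mulg1; apply.
  exact: trivial_on_square.
by case: fB.
Qed.

(** In the extension attached to [f] the letters are still involutions, so cancellation does not
    change values there. *)
Lemma basic_invariant_cancel w :
  trivial_on n w -> cancel_word w = [::] -> f w = false.
Proof.
move=> tw cw; apply: (ev_inv_ext_eq1 (fP := fP)) => //.
by rewrite -(ev_cancel _ inv_ext_letter2) cw.
Qed.

(** If [f] vanishes on [(ad)^4], the lifts of [a] and [d] to the extension of [f] still generate a
    dihedral group of exponent dividing 4. *)
Lemma basic_invariant_theta w : f (word4 [:: La; Ld]) = false ->
  trivial_on n (word4 (section false (sub_word w))) ->
  f (word4 (section false (sub_word w))) = false.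
Proof.
move=> f0 tw; apply: (ev_inv_ext_eq1 (fP := fP)) => //.
rewrite ev_word4 ev_ad_expg4 ?inv_ext_letter2 //.
have := inv_ext_letter1 fP (@trivial_on_ad n) f0.
by rewrite ev_word4 /= mulg1.
Qed.

Lemma lift_invariant_ad : lift_invariant f (word4 [:: La; Ld]) = false.
Proof. by case: fB => _ f2 _; rewrite /lift_invariant /= !f2. Qed.

Lemma lift_invariant_adacac :
  lift_invariant f (word4 [:: La; Ld; La; Lc; La; Lc]) = false.
Proof.
have /trivial_onS[_ tw] := @trivial_on_adacac n.+1.
by rewrite /lift_invariant !basic_invariant_cancel.
Qed.

Lemma lift_invariant_sub w : f (word4 [:: La; Ld]) = false ->
  trivial_on n.+1 (word4 (sub_word w)) ->
  lift_invariant f (word4 (sub_word w)) = f (word4 w).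
Proof.
move=> f0 /trivial_onS[_ /(_ false)].
rewrite /lift_invariant !section_word4 ?odd_a_sub // section_true_sub => tw.
by rewrite basic_invariant_theta // add0r.
Qed.

End BasicInvariant.

Lemma root0 k : root k 0 = [:: La; Ld].
Proof. by case: k. Qed.

(** A lifted invariant vanishes on the relators 0 and 1 and takes on relator [i + 2] the old value
    on relator [i], so induction handles the indices from 3 on. Two invariants of level 4 handle 1
    and 2. Index 0 is left out since lifting needs invariants that vanish on [(ad)^4]. *)
Lemma roots_independent k (lam : nat -> bool) :
  (forall f, basic_invariant k.+3 f -> f (word4 (root k 0)) = false ->
    \sum_(0 <= i < 2 * k + 3) lam i * f (word4 (root k i)) = 0)%R ->
  forall i, 0 < i < 2 * k + 3 -> lam i = false.
Proof.
elim: k lam => [|k IHk] lam.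
  move=> H i; have := H _ inv_ac4_basic erefl; have := H _ inv_acad_basic erefl.
  rewrite !big_nat_recl //= !big_geq //.
  case: (lam 0) => /=; case l1: (lam 1%N); case l2: (lam 2) => //= _ _;
  by case: i => [|[|[|i]]].
have -> : 2 * k.+1 + 3 = (2 * k + 3).+2 by rewrite mulnS -addnA add2n.
move=> H.
have lam0 i : 0 < i < 2 * k + 3 -> lam i.+2 = false.
  apply: (IHk (fun i => lam i.+2)) => f fB f0.
  have f0' := f0; rewrite root0 in f0'.
  have := H _ (lift_basic_invariant fB) (lift_invariant_ad fB).
  rewrite 2?big_nat_recl // (lift_invariant_ad fB) (lift_invariant_adacac fB).
  rewrite !mulr0 !add0r => {2}<-; apply: eq_bigr => j _.
  by rewrite /= (lift_invariant_sub fB) //; apply: (@trivial_on_root k.+1 j.+2).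
(* Invariants of level 4 are invariants of all higher levels, and the later relators have dropped
   out of the sum. *)
have H' f : basic_invariant 4 f -> f (word4 [:: La; Ld]) = false ->
    (lam 1%N * f (word4 [:: La; Ld; La; Lc; La; Lc]) +
     lam 2 * f (word4 (sub_word [:: La; Ld])) = 0)%R.
  case=> fP f2 fb f0; have fB : basic_invariant k.+4 f.
    by split=> //; apply: invariant_le fP.
  rewrite -[RHS](H f fB f0) addn3 3?big_nat_recl //= f0 mulr0 add0r.
  rewrite root0 big_nat_cond big1 ?addr0 // => j /andP[/andP[_ jm] _].
  by rewrite lam0 ?mul0r //= addn3.
have := H' _ inv_ac8_basic erefl; have := H' _ inv_octagon_basic erefl.
case l1: (lam 1%N); case l2: (lam 2) => // _ _ [|[|[|i]]] // im.
exact: lam0.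
Qed.

Local Open Scope ring_scope.

(** * The bar complex *)

Section FreeLift.
Variables (K : choiceType) (V : zmodType).

Definition zlift (F : K -> V) : {freeg K} -> V :=
  fglift (F : K -> (zmodule V)).

Lemma zlift_is_zmod_morphism F : zmod_morphism (zlift F).
Proof. exact: (@lift_is_additive _ _ (zmodule V)). Qed.

HB.instance Definition _ F :=
  GRing.isZmodMorphism.Build {freeg K} V (zlift F) (zlift_is_zmod_morphism F).

Lemma zliftU F x : zlift F << x >> = F x.
Proof. by rewrite /zlift liftU scale1r. Qed.

Lemma freeg_additive_ext (F1 F2 : {additive {freeg K} -> V}) :
  (forall x, F1 << x >> = F2 << x >>) -> F1 =1 F2.
Proof.
move=> F12 D; rewrite -(freeg_sumE D) !raddf_sum; apply: eq_bigr => x _.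
have -> : << coeff x D *g x >> = << x >> *~ coeff x D :> {freeg K}.
  by rewrite freegU_mulz intz.
by rewrite !raddfMz F12.
Qed.

End FreeLift.

Arguments bar_boundary {G k} : simpl never.

Section BarWords.
Variable G : groupType.

Definition bar1 (g : G) : bar_chain G 1 := << [tuple g] >>.
Definition bar2 (g h : G) : bar_chain G 2 := << [tuple g; h] >>.
Definition bar3 (g h k : G) : bar_chain G 3 := << [tuple g; h; k] >>.

Lemma bar_boundary2 g h :
  bar_boundary (bar2 g h) = bar1 h - bar1 (g * h)%g + bar1 g.
Proof.
rewrite /bar_boundary /bar2 liftU scale1r !big_ord_recl big_ord0.
rewrite /= expr0 !exprS expr0 !mulr1 mulN1r opprK !scale1r scaleN1r addr0 addrA.
rewrite /bar1; congr (<< _ >> - << _ >> + << _ >>);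
by apply: eq_from_tnth => -[[|i] li]; rewrite ?tnth_mktuple //= ?(tnth_nth 1%g).
Qed.

Lemma bar_boundary3 g h k :
  bar_boundary (bar3 g h k) =
  bar2 h k - bar2 (g * h)%g k + bar2 g (h * k)%g - bar2 g h.
Proof.
rewrite /bar_boundary /bar3 liftU scale1r !big_ord_recl big_ord0.
rewrite /= expr0 !exprS expr0 !mulr1 !mulN1r !opprK !scale1r !scaleN1r addr0 !addrA.
rewrite /bar2; congr (<< _ >> - << _ >> + << _ >> - << _ >>);
by apply: eq_from_tnth => -[[|[|i]] li]; rewrite ?tnth_mktuple //= ?(tnth_nth 1%g).
Qed.

Lemma bar2P (t : 2.-tuple G) : exists g h, << t >> = bar2 g h :> bar_chain G 2.
Proof.
case/tupleP: t => g t; case/tupleP: t => h t; exists g, h.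
by congr (<< _ >>); apply: val_inj; rewrite /= (tuple0 t).
Qed.

Lemma bar3P (t : 3.-tuple G) : exists g h k, << t >> = bar3 g h k :> bar_chain G 3.
Proof.
case/tupleP: t => g t; case/tupleP: t => h t; case/tupleP: t => k t.
by exists g, h, k; congr (<< _ >>); apply: val_inj; rewrite /= (tuple0 t).
Qed.

Variable gam : letter -> G.

(** The base value is the first coordinate of the identity in the extension by the unnormalized
    cocycle [bar2]. *)
Fixpoint chain_word (w : letterword) : bar_chain G 2 :=
  if w is l :: w' then chain_word w' + bar2 (gam l) (ev gam w') else - bar2 1%g 1%g.

(* If w = 1 in G, this chain represents the value of w in the central extension
   of G by 2-chains modulo boundaries, each letter being lifted trivially. *)
Definition rel_chain (w : letterword) : bar_chain G 2 := chain_word w + bar2 1%g 1%g.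

Lemma bar_boundary_chain_word w :
  bar_boundary (chain_word w) = \sum_(l <- w) bar1 (gam l) - bar1 (ev gam w).
Proof.
elim: w => [|l w IHw] /=.
  by rewrite big_nil raddfN /= bar_boundary2 mulg1 subrr add0r sub0r.
rewrite raddfD /= IHw bar_boundary2 big_cons.
by rewrite !addrA subrK addrAC [bar1 (gam l) + _]addrC.
Qed.

Lemma bar_boundary_rel_chain w : ev gam w = 1%g ->
  bar_boundary (rel_chain w) = \sum_(l <- w) bar1 (gam l).
Proof.
move=> w1; rewrite raddfD /= bar_boundary_chain_word w1 bar_boundary2 mulg1.
by rewrite subrr add0r subrK.
Qed.

(** * Pushing the extension by 2-chains out along a homomorphism *)

Section Pushout.
Variables (A : zmodType) (alpha : G -> G -> A) (P : {additive bar_chain G 2 -> A}).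
Hypothesis alphaP : cocycle alpha.
Hypothesis PE : forall g h, P (bar2 g h) = alpha g h.
Local Notation E := (cext alphaP).

Definition trivial_lift (l : letter) : E := (0, gam l).

Lemma ev_trivial_lift w : ev trivial_lift w = (P (chain_word w), ev gam w).
Proof.
elim: w => [|l w IHw] /=; first by rewrite raddfN /= PE.
by rewrite IHw cext_mulE raddfD /= PE add0r.
Qed.

Lemma ev_trivial_lift_rel w : ev gam w = 1%g ->
  ev trivial_lift w = central alphaP (P (rel_chain w)).
Proof.
by move=> w1; rewrite ev_trivial_lift w1 /central raddfD /= PE addrK.
Qed.

Lemma pushout_boundary (c : bar_chain G 3) : P (bar_boundary c) = 0.
Proof.
apply: (freeg_additive_ext (F1 := P \o @bar_boundary G 3) (F2 := \0)) => t.
rewrite /=; have [g [h [k ->]]] := bar3P t.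
rewrite bar_boundary3 !raddfB raddfD raddfB /= !PE; apply/eqP.
by rewrite subr_eq0 addrAC subr_eq alphaP.
Qed.

Hypothesis gam_surj : forall g, exists w, ev gam w = g.

(** Since relators vanish, words with equal value in [G] have equal lifts. Hence the chosen words
    [s g] split the extension, and [P] factors through the boundary map by the 1-cochain [Kf]. *)
Lemma pushout_cycle :
  (forall w, ev gam w = 1%g -> P (rel_chain w) = 0) ->
  forall z : bar_chain G 2, bar_boundary z = 0 -> P z = 0.
Proof.
move=> rel0.
pose s g := sval (cid (gam_surj g)).
have sE g : ev gam (s g) = g by rewrite /s; case: cid.
have evE u v : ev gam u = ev gam v -> ev trivial_lift u = ev trivial_lift v.
  move=> uv; pose x := s (ev gam v)^-1%g.
  apply: (mulIg (ev trivial_lift x)); rewrite -!ev_cat !ev_trivial_lift_rel.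
  - by rewrite !rel0 // ev_cat sE ?uv mulgV.
  - by rewrite ev_cat sE mulgV.
  - by rewrite ev_cat sE uv mulgV.
pose Kf (t : 1.-tuple G) := - P (chain_word (s (thead t))).
suff PK : P =1 (zlift Kf \o @bar_boundary G 2) by move=> z z0; rewrite PK /= z0 raddf0.
apply: freeg_additive_ext => t /=; have [g [h ->]] := bar2P t.
rewrite bar_boundary2 raddfD raddfB /= !zliftU /Kf !theadE PE.
have eq_gh : ev gam (s g ++ s h) = ev gam (s (g * h)%g) by rewrite ev_cat !sE.
have := congr1 fst (evE _ _ eq_gh).
rewrite ev_cat !ev_trivial_lift /= !sE => <-.
rewrite opprK [P (chain_word (s g)) + _]addrC -[_ + _ + alpha g h]addrA addKr.
by rewrite addrAC subrr add0r.
Qed.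

End Pushout.

(** The boundary of [bar2 g h] is a coboundary in [g] and [h], hence a cocycle, and cocycles vanish
    on boundaries. *)
Lemma bar_boundaryK (c : bar_chain G 3) : bar_boundary (bar_boundary c) = 0.
Proof.
pose alpha g h := bar_boundary (bar2 g h).
have alphaP : cocycle alpha.
  move=> g h l; rewrite /alpha !bar_boundary2 mulgA.
  move: (bar1 _) (bar1 _) (bar1 g) (bar1 l) (bar1 _) (bar1 _) => y x z u w v.
  rewrite (addrAC v) [LHS]addrACA addNr addr0.
  rewrite [y - x]addrC -(addrA (- x)) (addrC y) (addrA (- x)) [u - y + v]addrAC.
  by rewrite [RHS]addrACA addNr addr0 (addrC u v) (addrC (- x)) addrACA.
exact: (pushout_boundary (P := @bar_boundary G 2) alphaP).
Qed.

Definition square_chain (l : letter) : bar_chain G 2 := rel_chain [:: l; l].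

(** The correction makes this a cycle: each occurrence of a letter in [w] contributes four copies of
    it to the boundary of either term. *)
Definition power_chain (w : letterword) : bar_chain G 2 :=
  rel_chain (word4 w) - (\sum_(l <- w) square_chain l) *+ 2.

(** This is the commutator of [b] and [c]: with [r] the central lift of [bcd], [(bc)^2 = r^2 d^-2],
    and the commutator is [(bc)^2 b^-2 c^-2] because squares are central. *)
Definition klein_chain : bar_chain G 2 :=
  rel_chain [:: Lb; Lc; Ld] *+ 2 -
  (square_chain Lb + square_chain Lc + square_chain Ld).

Hypothesis gamB : basic gam.

Lemma gam2 l : ev gam [:: l; l] = 1%g.
Proof. by case: gamB => a2 b2 c2 d2 _; case: l; rewrite /= mulg1. Qed.

Lemma gam_bcd : ev gam [:: Lb; Lc; Ld] = 1%g.
Proof. by case: gamB => _ _ _ _ bcd; rewrite /= mulg1 mulgA. Qed.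

Lemma bar_boundary_square l : bar_boundary (square_chain l) = bar1 (gam l) *+ 2.
Proof. by rewrite bar_boundary_rel_chain ?gam2 // !big_cons big_nil addr0. Qed.

Lemma bar_boundary_bcd : bar_boundary (rel_chain [:: Lb; Lc; Ld]) =
  bar1 (gam Lb) + bar1 (gam Lc) + bar1 (gam Ld).
Proof.
by rewrite bar_boundary_rel_chain ?gam_bcd // !big_cons big_nil addr0 addrA.
Qed.

Lemma bar_boundary_power w : ev gam (word4 w) = 1%g ->
  bar_boundary (power_chain w) = 0.
Proof.
move=> w1; rewrite raddfB raddfMn raddf_sum /= bar_boundary_rel_chain //.
under [X in _ - X *+ 2]eq_bigr => l _ do rewrite bar_boundary_square.
by rewrite sumrMnl !big_cat /= !mulr2n !addrA subrr.
Qed.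

Lemma bar_boundary_klein : bar_boundary klein_chain = 0.
Proof.
rewrite /klein_chain; move: bar_boundary_bcd bar_boundary_square.
move: (rel_chain _) square_chain => r sq rE sqE.
by rewrite raddfB raddfMn !raddfD /= rE !sqE !mulrnDl -!opprD subrr.
Qed.

(** * The cycles have order at most two *)

Section Torsion.
Variables (A : zmodType) (alpha : G -> G -> A) (P : {additive bar_chain G 2 -> A}).
Hypothesis alphaP : cocycle alpha.
Hypothesis PE : forall g h, P (bar2 g h) = alpha g h.
Local Notation E := (cext alphaP).
Local Notation cen := (central alphaP).

Lemma central_expg (x y : E) (s t : A) n :
  (x * x)%g = cen s -> (y * y)%g = cen t ->
  ((x * y) ^+ n * (y * x) ^+ n)%g = cen ((s + t) *+ n).
Proof.
move=> xx yy; elim: n => [|n IHn]; first by rewrite mulg1 central0.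
rewrite expgSr expgS -!mulgA (mulgA y y) yy (mulgA x (cen t)).
rewrite -[(x * cen t)%g](central_commute t x) -!mulgA (mulgA x x) xx.
rewrite [(cen t * _)%g]mulgA -centralD mulgA -[(_ * cen _)%g]central_commute -mulgA IHn.
by rewrite -centralD mulrS [t + s]addrC.
Qed.

(** [y * x] is a conjugate of [x * y], so both have the same central power; [central_expg] evaluates
    the product of the two powers. *)
Lemma central_expg_eq (x y : E) (s t r : A) n :
  (x * x)%g = cen s -> (y * y)%g = cen t -> ((x * y) ^+ n)%g = cen r ->
  r *+ 2 = (s + t) *+ n.
Proof.
move=> xx yy xyn; apply: (@central_inj _ _ _ alphaP); rewrite -(central_expg n xx yy).
have -> : (y * x = (x * y) ^ x)%g by rewrite conjgE !mulgA mulVg mul1g.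
have cJ : (cen r ^ x)%g = cen r by rewrite conjgE central_commute mulKg.
by rewrite -conjXg xyn cJ -centralD mulr2n.
Qed.

Lemma ev_trivial_lift_rev w :
  ev (trivial_lift alphaP) (w ++ rev w) = cen (\sum_(l <- w) P (square_chain l)).
Proof.
elim: w => [|l w IHw]; first by rewrite big_nil central0.
have sq := ev_trivial_lift_rel alphaP PE (gam2 l); rewrite /= mulg1 in sq.
rewrite rev_cons -cats1 /= !ev_cat /= mulg1 (mulgA (ev _ w)) -ev_cat IHw.
by rewrite central_commute mulgA sq big_cons centralD.
Qed.

(** The square of a palindrome cancels from the middle to a central product of squares of letters.
    Then [central_expg_eq] with exponent 4 applies. *)
Lemma torsion_power x y : rev x = x -> rev y = y ->
  ev gam (word4 (x ++ y)) = 1%g -> P (power_chain (x ++ y)) *+ 2 = 0.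
Proof.
move=> xV yV xy1.
have xx := ev_trivial_lift_rev x; rewrite xV ev_cat in xx.
have yy := ev_trivial_lift_rev y; rewrite yV ev_cat in yy.
have := ev_trivial_lift_rel alphaP PE xy1; rewrite ev_word4 ev_cat.
move/(central_expg_eq xx yy); rewrite raddfB raddfMn raddf_sum /= big_cat /=.
by rewrite mulrnBl => ->; rewrite -mulrnA subrr.
Qed.

Lemma torsion_klein : P klein_chain *+ 2 = 0.
Proof.
have sq l : (trivial_lift alphaP l * trivial_lift alphaP l)%g = cen (P (square_chain l)).
  by have := ev_trivial_lift_rel alphaP PE (gam2 l); rewrite /= mulg1.
have := ev_trivial_lift_rel alphaP PE gam_bcd; rewrite /= mulg1 mulgA.
set r := P _; set x := trivial_lift _ Lb; set y := trivial_lift _ Lc.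
set z := trivial_lift _ Ld => xyz.
(* Both [z * z] and [x * y * z] are central, so the square of [x * y] times that of [z] is the
   square of [x * y * z]. *)
have xy2 : ((x * y) ^+ 2)%g = cen (r *+ 2 - P (square_chain Ld)).
  have zz : (z * z)%g = cen (P (square_chain Ld)) := sq Ld.
  apply: (mulIg (z * z)%g); rewrite [in RHS]zz -centralD subrK mulr2n centralD.
  by rewrite expg2 -mulgA (mulgA _ z z) xyz central_commute mulgA xyz.
have := central_expg_eq (sq Lb) (sq Lc) xy2; rewrite mulrnBl => H.
rewrite /klein_chain raddfB raddfMn.
have -> : P (square_chain Lb + square_chain Lc + square_chain Ld) =
    P (square_chain Lb) + P (square_chain Lc) + P (square_chain Ld).
  by rewrite [LHS]raddfD [X in X + _]raddfD.
by rewrite mulrnBl [(_ + _ + _) *+ 2]mulrnDl -H subrK subrr.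
Qed.

End Torsion.

End BarWords.

(** * Generators of the Schur multiplier *)

Section BoundedPred.
Variable G : groupType.

Definition is_boundary : {pred bar_chain G 2} :=
  fun x => `[< exists c : bar_chain G 3, x = bar_boundary c >].

Lemma is_boundary_zmod_closed : zmod_closed is_boundary.
Proof.
split=> [|x y /asboolP[c ->] /asboolP[c' ->]]; apply/asboolP.
  by exists 0; rewrite raddf0.
by exists (c - c'); rewrite raddfB.
Qed.

HB.instance Definition _ := GRing.isZmodClosed.Build (bar_chain G 2)
  is_boundary is_boundary_zmod_closed.

Variable I : zmodClosed (bar_chain G 2).
Hypothesis boundaryI : forall c : bar_chain G 3, bar_boundary c \in I.
Local Notation Q := (Quotient.quot I).

Lemma pi_quot_eq0 x : (\pi_Q x)%qT = 0 <-> x \in I.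
Proof.
rewrite -[x in x \in I]subr0 Quotient.idealrBE.
have -> : 0 = (\pi_Q 0)%qT :> Q by rewrite raddf0.
by split=> /eqP.
Qed.

Definition quot_cochain (g h : G) : Q := (\pi_Q (bar2 g h))%qT.

Lemma quot_cochainP : cocycle quot_cochain.
Proof.
move=> g h l; apply/esym/eqP; rewrite -subr_eq0 opprD addrA; apply/eqP.
have /pi_quot_eq0 := boundaryI (bar3 g h l).
rewrite bar_boundary3 !raddfB raddfD raddfB /= => <-.
rewrite [LHS]addrAC; congr (_ - _); exact: addrAC.
Qed.

End BoundedPred.

Lemma root_min k i : root k i = root k (minn i (2 * k + 2)).
Proof.
elim: k i => [|k IHk] i; first by case: i => [|[|[|i]]].
by case: i => [|[|i]]; rewrite mulnS -addnA add2n ?minnSS ?min0n //= IHk.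
Qed.

Lemma sub_word_rev w : rev (sub_word w) = sub_word (rev w).
Proof.
elim: w => //= l w IHw; rewrite rev_cat IHw rev_cons -cats1 sub_word_cat.
by case: l.
Qed.

Lemma root_palindromes k i :
  exists x y, [/\ root k i = x ++ y, rev x = x & rev y = y].
Proof.
elim: k i => [|k IHk] i.
  case: i => [|[|i]]; [exists [:: La], [:: Ld]|exists [:: La], [:: Lc]|
                       exists [:: La; Lc; La], [:: Ld]]; by [].
case: i => [|[|i]]; [by exists [:: La], [:: Ld]|
  by exists [:: La; Ld; La], [:: Lc; La; Lc]|].
have [x [y [xyE xV yV]]] := IHk i; exists (sub_word x), (sub_word y).
by rewrite /= xyE sub_word_cat !sub_word_rev xV yV.
Qed.

Section SchurMultiplier.
Variable k : nat.
Local Notation n := k.+3.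
Local Notation G := (grigorchuk_quotient n).
Local Notation gam := (quo_letter n).
Local Notation m := (2 * k + 3)%N.

Let gamB : basic gam := quo_letter_basic n.

Definition root_chain (i : nat) : bar_chain G 2 := power_chain gam (root k i).

Lemma ev_root4 i : ev gam (word4 (root k i)) = 1%g.
Proof. exact/ev_quo_letterP/trivial_on_root. Qed.

(** The chains of squares and of [bcd] are not cycles; they are included so that every defining
    relation holds in the extension by the quotient. *)
Definition relator_span : {pred bar_chain G 2} := fun x =>
  `[< exists (K : nat -> int) (L : letter -> int) (t : int) (c : bar_chain G 3),
      x = \sum_(0 <= i < m) root_chain i *~ K i +
          (square_chain gam La *~ L La + square_chain gam Lb *~ L Lb +
           square_chain gam Lc *~ L Lc + square_chain gam Ld *~ L Ld) +
          rel_chain gam [:: Lb; Lc; Ld] *~ t + bar_boundary c >].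

Lemma relator_span_zmod_closed : zmod_closed relator_span.
Proof.
split=> [|x y /asboolP[K [L [t [c ->]]]] /asboolP[K' [L' [t' [c' ->]]]]]; apply/asboolP.
  exists (fun=> 0), (fun=> 0), 0, 0; rewrite [bar_boundary 0]raddf0 !mulr0z !addr0.
  by rewrite big1 // => i _; rewrite mulr0z.
exists (fun i => K i - K' i), (fun l => L l - L' l), (t - t'), (c - c').
rewrite !mulrzBr.
have -> : \sum_(0 <= i < m) root_chain i *~ (K i - K' i) =
    \sum_(0 <= i < m) root_chain i *~ K i - \sum_(0 <= i < m) root_chain i *~ K' i.
  by rewrite -sumrB; apply: eq_bigr => i _; rewrite mulrzBr.
rewrite !opprD.
do ?(rewrite addrACA; congr (_ + _)).
by rewrite [RHS]raddfB.
Qed.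

HB.instance Definition _ := GRing.isZmodClosed.Build (bar_chain G 2)
  relator_span relator_span_zmod_closed.

Lemma square_relator_span l : square_chain gam l \in relator_span.
Proof.
apply/asboolP; exists (fun=> 0), (fun l' => (letter_code l == letter_code l')%:R), 0, 0.
rewrite [bar_boundary 0]raddf0 mulr0z !addr0 big1 ?add0r => [|i _]; last by rewrite mulr0z.
by case: l; rewrite /= !mulr0z ?mulr1z ?addr0 ?add0r.
Qed.

Lemma bcd_relator_span : rel_chain gam [:: Lb; Lc; Ld] \in relator_span.
Proof.
apply/asboolP; exists (fun=> 0), (fun=> 0), 1, 0.
by rewrite [bar_boundary 0]raddf0 !mulr0z !addr0 mulr1z big1 ?add0r.
Qed.

Lemma boundary_relator_span (c : bar_chain G 3) : bar_boundary c \in relator_span.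
Proof.
apply/asboolP; exists (fun=> 0), (fun=> 0), 0, c.
by rewrite !mulr0z !addr0 big1 ?add0r // => i _; rewrite mulr0z.
Qed.

Lemma root_relator_span i : (i < m)%N -> root_chain i \in relator_span.
Proof.
move=> im; apply/asboolP; exists (fun j => (i == j)%:R), (fun=> 0), 0, 0.
rewrite [bar_boundary 0]raddf0 !mulr0z !addr0 big_mkord.
rewrite (bigD1 (Ordinal im)) //= eqxx mulr1z big1 ?addr0 // => j /negP ij.
by rewrite eq_sym; case: eqP => [ji|]; [case: ij; apply/eqP/val_inj | rewrite mulr0z].
Qed.

Lemma relator_span_relations (c0 := quot_cochainP boundary_relator_span) :
  relations k (trivial_lift gam c0).
Proof.
pose P : {additive bar_chain G 2 -> Quotient.quot relator_span} :=
  (\pi_(Quotient.quot relator_span))%qT.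
have PE g h : P (bar2 g h) = quot_cochain relator_span g h by [].
have rel1 w : ev gam w = 1%g -> rel_chain gam w \in relator_span ->
    ev (trivial_lift gam c0) w = 1%g.
  move=> w1 /pi_quot_eq0 w0.
  rewrite (ev_trivial_lift_rel c0 PE w1) (_ : P _ = 0) ?central0 //.
split=> [|i].
  have sq l : (trivial_lift gam c0 l * trivial_lift gam c0 l = 1)%g.
    by have := rel1 [:: l; l] (gam2 gamB l) (square_relator_span l); rewrite /= mulg1.
  split=> //.
  by have := rel1 _ (gam_bcd gamB) bcd_relator_span; rewrite /= mulg1 mulgA.
rewrite -ev_word4; apply: rel1; first exact: ev_root4.
(* Larger indices repeat the last root, so the chains with index below [m] suffice. *)
rewrite root_min; set j := minn _ _.
have jm : (j < m)%N by rewrite addnS ltnS geq_minr.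
rewrite -(subrK ((\sum_(l <- root k j) square_chain gam l) *+ 2) (rel_chain _ _)).
apply: rpredD; first exact: root_relator_span.
by rewrite rpredMn // rpred_sum // => l _; apply: square_relator_span.
Qed.

(** By [presentation] the chain of every relator dies modulo the span, and [pushout_cycle] passes
    from relators to cycles. *)
Lemma cycle_relator_span z : bar_boundary z = 0 -> z \in relator_span.
Proof.
pose P : {additive bar_chain G 2 -> Quotient.quot relator_span} :=
  (\pi_(Quotient.quot relator_span))%qT.
have PE g h : P (bar2 g h) = quot_cochain relator_span g h by [].
move=> z0; apply/pi_quot_eq0.
pose c0 := quot_cochainP boundary_relator_span.
apply: (pushout_cycle c0 PE (@ev_quo_surj n)) z0 => w w1.
have := ev_trivial_lift_rel c0 PE w1.
rewrite (presentation relator_span_relations) ?(central0 c0).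
  by rewrite -(central0 c0) => /central_inj.
exact/ev_quo_letterP.
Qed.

Lemma quo_letter_inj l l' : gam l = gam l' -> l = l'.
Proof.
move=> ll; have : trivial_on 3 [:: l; l'].
  apply: (@trivial_on_le n) => //; apply/ev_quo_letterP.
  by rewrite /= ll mulg1 quo_letter2.
(* The images of 100 and 000 distinguish the four letters. *)
move=> t; have := t [:: true; false; false] erefl.
have := t [:: false; false; false] erefl.
by case: l l' {ll t} => -[].
Qed.

Lemma coeff_bar1 l l' :
  coeff [tuple gam l] (bar1 (gam l')) = (letter_code l == letter_code l')%:R.
Proof.
rewrite coeffU mul1r; congr (_%:R); congr nat_of_bool.
have [ll|nll] := eqVneq (letter_code l) (letter_code l').
  have -> : l = l' by case: l l' ll => -[].
  by rewrite eqxx.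
apply/eqP => /(congr1 (@thead _ _)); rewrite !theadE => /quo_letter_inj ll.
by rewrite ll eqxx in nll.
Qed.

(** A vanishing boundary forces [L La = 0] and [2 L l + t = 0] for the other letters, so the squares
    and [bcd] combine into a multiple of [klein_chain]. *)
Lemma cycle_span (z : bar_chain G 2) : bar_boundary z = 0 ->
  exists (K : nat -> int) (t : int) (c : bar_chain G 3),
    z = \sum_(0 <= i < m) root_chain i *~ K i + klein_chain gam *~ t + bar_boundary c.
Proof.
move=> z0; have /asboolP[K [L [t [c zE]]]] := cycle_relator_span z0.
have dz : bar_boundary z = bar1 (gam La) *+ 2 *~ L La + bar1 (gam Lb) *+ 2 *~ L Lb +
    bar1 (gam Lc) *+ 2 *~ L Lc + bar1 (gam Ld) *+ 2 *~ L Ld +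
    (bar1 (gam Lb) + bar1 (gam Lc) + bar1 (gam Ld)) *~ t.
  have dr : bar_boundary (\sum_(0 <= i < m) root_chain i *~ K i) = 0.
    rewrite raddf_sum big1 // => i _.
    by rewrite raddfMz /= bar_boundary_power ?mul0rz ?ev_root4.
  have dsq := bar_boundary_square gamB; have dbcd := bar_boundary_bcd gamB.
  have dd := bar_boundaryK c; move: dr dsq dbcd dd; rewrite zE.
  move: (\sum_(_ <= i < _) _) (square_chain gam) (rel_chain _ _) (bar_boundary c).
  move=> r sq b e dr dsq db de.
  by rewrite !raddfD /= !raddfMz /= dr de db !dsq add0r addr0.
have coefE l : coeff [tuple gam l] (bar_boundary z) =
    L l *+ 2 + (if l is La then 0 else t).
  rewrite dz !raddfD /= !raddfMz /= !raddfMn !raddfD /= !coeff_bar1.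
  by case: l; rewrite /= ?mul0rn ?mul0rz ?addr0 ?add0r !mulrzz ?mul1r mulr_natl.
have La0 : L La = 0.
  by have /eqP := coefE La; rewrite z0 raddf0 addr0 eq_sym Num.Theory.mulrn_eq0 => /eqP.
have tE l : l <> La -> t = - (L l *+ 2).
  case: l (coefE l) => // + _; rewrite z0 raddf0 addrC => /esym/eqP;
  by rewrite addr_eq0 => /eqP.
have LE l : l <> La -> L l = L Lb.
  move=> la; have := tE l la; rewrite (tE Lb) // => /oppr_inj/esym/eqP.
  by rewrite -subr_eq0 -mulrnBl Num.Theory.mulrn_eq0 subr_eq0 => /eqP.
exists K, (- L Lb), c; rewrite zE; congr (_ + _); rewrite -addrA; congr (_ + _).
rewrite La0 mulr0z add0r (LE Lc) // (LE Ld) // (tE Lb) // /klein_chain.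
move: (square_chain gam) (rel_chain _ _) (L Lb) => sq r x.
by rewrite !mulrNz mulrzBl opprB !mulr2n !(mulrzDl, mulrzDr).
Qed.

(** * Pairing 2-chains with invariants *)

Section InvariantPairing.
Variable f : letterword -> bool.
Hypothesis fP : invariant n f.

Definition inv_pairing : bar_chain G 2 -> bool :=
  zlift (fun t : 2.-tuple G => inv_cocycle f (thead t) (thead (behead_tuple t))).

HB.instance Definition _ := GRing.Additive.on inv_pairing.

Lemma inv_pairingE g h : inv_pairing (bar2 g h) = inv_cocycle f g h.
Proof. by rewrite /inv_pairing zliftU !theadE. Qed.

(** The sum over letters arises because [trivial_lift] and [inv_ext_letter] lift letters
    differently; it cancels on the cycles considered below. *)
Lemma inv_pairing_rel w : ev gam w = 1%g ->
  inv_pairing (rel_chain gam w) = f w + \sum_(l <- w) inv_lift n f [:: l].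
Proof.
move=> w1; have tw : trivial_on n w by apply/ev_quo_letterP.
have := congr1 fst (ev_inv_ext_trivial fP tw).
rewrite (ev_cext_shift (inv_cocycleP fP) (fun l => inv_lift n f [:: l]) gam).
have := congr1 fst (ev_trivial_lift_rel (inv_cocycleP fP) inv_pairingE w1).
rewrite /central /= => ->.
move: (inv_pairing _) (f w) (\sum_(_ <- _) _) (inv_cocycle _ _ _).
by do 4! case.
Qed.

Lemma inv_pairing_square l : inv_pairing (square_chain gam l) = f [:: l; l].
Proof.
rewrite inv_pairing_rel ?gam2 // !big_cons big_nil addr0.
by rewrite bool_addrr addr0.
Qed.

Lemma inv_pairing_root i : inv_pairing (root_chain i) = f (word4 (root k i)).
Proof.
rewrite raddfB raddfMn /= mulr2n bool_addrr subr0 inv_pairing_rel ?ev_root4 //.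
by rewrite !big_cat /= addrA !bool_addrr !addr0.
Qed.

Lemma inv_pairing_klein : inv_pairing (klein_chain gam) =
  f [:: Lb; Lb] + f [:: Lc; Lc] + f [:: Ld; Ld].
Proof.
rewrite -!inv_pairing_square /klein_chain.
move: (square_chain gam) (rel_chain _ _) => sq r.
by rewrite raddfB raddfMn mulr2n bool_addrr sub0r bool_oppr !raddfD.
Qed.

Lemma inv_pairing_boundary (c : bar_chain G 3) : inv_pairing (bar_boundary c) = 0.
Proof. exact: (pushout_boundary (inv_cocycleP fP) inv_pairingE). Qed.

End InvariantPairing.

(** Basic invariants do not see [klein_chain]: [roots_independent] removes the positive indices and
    [inv_ad] the index 0, after which [inv_klein] isolates [t]. *)
Lemma chains_independent (lam : nat -> bool) (t : bool) (c : bar_chain G 3) :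
  \sum_(0 <= i < m) root_chain i *+ lam i + klein_chain gam *+ t = bar_boundary c ->
  (forall i, (i < m)%N -> lam i = false) /\ t = false.
Proof.
move=> E.
have pair f (fP : invariant n f) : \sum_(0 <= i < m) lam i * f (word4 (root k i)) +
    t * (f [:: Lb; Lb] + f [:: Lc; Lc] + f [:: Ld; Ld]) = 0.
  rewrite -[RHS](inv_pairing_boundary fP c) -E raddfD raddf_sum /=.
  rewrite raddfMn /= inv_pairing_klein //.
  congr (_ + _); last by case: (t); rewrite ?mul0r ?mul1r.
  apply: eq_bigr => i _; rewrite raddfMn /= inv_pairing_root //.
  by case: (lam i); rewrite ?mul0r ?mul1r.
have pairB f (fB : basic_invariant n f) :
    \sum_(0 <= i < m) lam i * f (word4 (root k i)) = 0.
  by have [fP f2 _] := fB; have := pair f fP; rewrite !f2 !addr0 mulr0 addr0.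
have lamS i : (0 < i < m)%N -> lam i = false.
  by apply: (@roots_independent k) => f fB _; apply: pairB.
have sumE (f : letterword -> bool) :
    \sum_(0 <= i < m) lam i * f (word4 (root k i)) = lam 0%N * f (word4 [:: La; Ld]).
  rewrite addn3 big_nat_recl // root0 big_nat_cond big1 ?addr0 // => i.
  by move=> /andP[/andP[_ im] _]; rewrite lamS ?mul0r //= addn3.
have lam0 : lam 0%N = false.
  have [adP ad2 adb] := inv_ad_basic.
  have adB : basic_invariant n inv_ad by split=> //; apply: invariant_le adP.
  by have := pairB _ adB; rewrite sumE; case: (lam 0%N).
have lamE i : (i < m)%N -> lam i = false by case: i => // i im; apply: lamS.
split=> //; have := pair _ (invariant_le _ inv_klein_invariant).
rewrite sumE lam0 mul0r add0r => /(_ isT).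
by case: (t).
Qed.

End SchurMultiplier.

(** * The isomorphism *)

Section ElementaryAbelian.
Variables (V : zmodType) (m : nat) (v : 'I_m -> V).
Hypothesis v2 : forall i, v i *+ 2 = 0.

Lemma mulrn_Z2B i (x y : 'Z_2) : v i *+ (x - y)%R = v i *+ x - v i *+ y.
Proof.
have vN : - v i = v i by apply/eqP; rewrite eq_sym -addr_eq0 -mulr2n v2.
by case: x y => -[|[|x]] // lx [[|[|y]]] // ly;
rewrite /= ?mulr0n ?mulr1n ?subr0 ?subrr ?sub0r ?vN.
Qed.

Lemma mulrz_odd i (K : int) : v i *~ K = v i *+ (inZp (odd `|K|%N) : 'Z_2).
Proof.
have odd_n n : v i *+ n = v i *+ (inZp (odd n) : 'Z_2).
  rewrite -[in LHS](odd_double_half n) mulrnDr -mul2n mulrnA v2 mul0rn addr0.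
  by case: (odd n).
case: K => n; first by rewrite -pmulrn odd_n.
rewrite NegzE mulrNz -pmulrn abszN absz_nat odd_n.
by case: (odd _); rewrite /= ?mulr0n ?oppr0 //; apply/eqP;
rewrite eq_sym -addr_eq0 -mulr2n v2.
Qed.

Hypothesis v_span : forall x, exists K : 'I_m -> int, x = \sum_i v i *~ K i.
Hypothesis v_indep : forall lam : 'I_m -> bool,
  \sum_i v i *+ lam i = 0 -> forall i, lam i = false.

Definition Z2_comb (a : {ffun 'I_m -> 'Z_2}) : V := \sum_i v i *+ a i.

Lemma Z2_comb_is_zmod_morphism : zmod_morphism Z2_comb.
Proof.
move=> a b; rewrite /Z2_comb -sumrB; apply: eq_bigr => i _.
by rewrite !ffunE mulrn_Z2B.
Qed.

HB.instance Definition _ := GRing.isZmodMorphism.Build _ _ Z2_comb Z2_comb_is_zmod_morphism.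

Lemma elementary_abelian_iso : zmod_isomorphic V {ffun 'I_m -> 'Z_2}.
Proof.
have inj : injective Z2_comb.
  apply: raddf_inj => a a0; apply/ffunP => i; rewrite ffunE; apply/eqP.
  have aE (x : 'Z_2) j : v j *+ (x != 0) = v j *+ x by case: x => -[|[]].
  apply/negbNE/negbT/(v_indep (lam := fun i => a i != 0)).
  by rewrite -[RHS]a0; apply: eq_bigr => j _; rewrite aE.
have surj x : exists a, Z2_comb a = x.
  have [K ->] := v_span x; exists [ffun i => inZp (odd `|K i|%N)].
  by apply: eq_bigr => i _; rewrite ffunE -mulrz_odd.
pose g x := sval (cid (surj x)).
have gK : cancel g Z2_comb by move=> x; rewrite /g; case: cid.
have Kg : cancel Z2_comb g by move=> a; apply: inj; rewrite gK.
have gB : zmod_morphism g by move=> x y; apply: inj; rewrite raddfB /= !gK.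
pose ga : {additive V -> {ffun 'I_m -> 'Z_2}} :=
  HB.pack g (GRing.isZmodMorphism.Build _ _ g gB).
by exists ga; exists Z2_comb.
Qed.

End ElementaryAbelian.

(** * Classes of cycles and the basis of the Schur multiplier *)

Section HomologyClass.
Variable G : groupType.

Definition cycle_class (z : bar_cycle G 2) : schur_multiplier G :=
  (\pi_(Quotient.quot (@bar_bound G 2)) z)%qT.

Lemma cycle_class_is_zmod_morphism : zmod_morphism cycle_class.
Proof. exact: raddfB. Qed.

HB.instance Definition _ := GRing.isZmodMorphism.Build _ _ cycle_class
  cycle_class_is_zmod_morphism.

Lemma cycle_class_eq0 z :
  cycle_class z = 0 <-> exists c : bar_chain G 3, cycle_val z = bar_boundary c.
Proof.
have -> : 0 = cycle_class 0 by rewrite raddf0.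
split=> [/eqP|zb]; last apply/eqP; rewrite -Quotient.idealrBE subr0; first by move/asboolP.
exact/asboolP.
Qed.

Lemma cycle_val_is_zmod_morphism : zmod_morphism (@cycle_val G 2).
Proof. by []. Qed.

HB.instance Definition _ := GRing.isZmodMorphism.Build _ _ (@cycle_val G 2)
  cycle_val_is_zmod_morphism.

Lemma cycle_class_surj (x : schur_multiplier G) : exists z, x = cycle_class z.
Proof. by exists (repr x); rewrite /cycle_class reprK. Qed.

End HomologyClass.

Section SchurIso.
Variable k : nat.
Local Notation G := (grigorchuk_quotient k.+3).
Local Notation gam := (quo_letter k.+3).
Local Notation m := (2 * k + 3)%N.

(** The last index [m] carries the commutator of [b] and [c]; with [n = k + 3] there are
    [m + 1 = 2n - 2] generators. *)
Definition generating_chain (i : nat) : bar_chain G 2 :=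
  if (i < m)%N then root_chain k i else klein_chain gam.

Lemma generating_chain_cycle i : generating_chain i \in @bar_cycle_pred G 2.
Proof.
apply/eqP; rewrite /generating_chain; have gamB := quo_letter_basic k.+3.
by case: ifP => _; rewrite ?bar_boundary_klein ?bar_boundary_power ?ev_root4.
Qed.

Definition generator (i : 'I_m.+1) : schur_multiplier G :=
  cycle_class (BarCycle (generating_chain_cycle i)).

Lemma sum_generating_chain (F : bar_chain G 2 -> nat -> bar_chain G 2) :
  \sum_(i < m.+1) F (generating_chain i) i =
  \sum_(0 <= i < m) F (root_chain k i) i + F (klein_chain gam) m.
Proof.
rewrite big_ord_recr /= {2}/generating_chain ltnn big_mkord; congr (_ + _).
by apply: eq_bigr => i _; rewrite /generating_chain ltn_ord.
Qed.

Lemma generator2 i : generator i *+ 2 = 0.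
Proof.
rewrite -raddfMn; apply/cycle_class_eq0; rewrite raddfMn /=.
(* Modulo the boundaries themselves, vanishing under [P] means being a boundary. *)
pose I : zmodClosed (bar_chain G 2) := @is_boundary G.
have bI (c : bar_chain G 3) : bar_boundary c \in I by apply/asboolP; exists c.
pose P : {additive bar_chain G 2 -> Quotient.quot I} := (\pi_(Quotient.quot I))%qT.
have PE g h : P (bar2 g h) = quot_cochain I g h by [].
have gamB := quo_letter_basic k.+3.
suff : P (generating_chain i) *+ 2 = 0.
  by rewrite -raddfMn => /pi_quot_eq0/asboolP.
rewrite /generating_chain; case: ifP => _.
  have [x [y [xyE xV yV]]] := root_palindromes k i.
  have := ev_root4 k i; rewrite /root_chain xyE.
  exact: (torsion_power gamB (quot_cochainP bI) PE xV yV).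
exact: (torsion_klein gamB (quot_cochainP bI) PE).
Qed.

Lemma generator_span x : exists K : 'I_m.+1 -> int, x = \sum_i generator i *~ K i.
Proof.
have [z ->] := cycle_class_surj x.
have [K [t [c zE]]] := cycle_span (eqP (cycle_valP z)).
pose K' i := if (i < m)%N then K i else t.
exists (fun i => K' i); apply/eqP; rewrite -subr_eq0; apply/eqP.
under eq_bigr => i _ do rewrite -raddfMz.
rewrite -raddf_sum -raddfB; apply/cycle_class_eq0; exists c.
rewrite raddfB raddf_sum /=.
under eq_bigr => i _ do rewrite raddfMz /=.
rewrite (sum_generating_chain (fun y i => y *~ K' i)) zE {2}/K' ltnn.
have -> : \sum_(0 <= i < m) root_chain k i *~ K' i =
    \sum_(0 <= i < m) root_chain k i *~ K i.
  by apply: eq_big_nat => i /andP[_ im]; rewrite /K' im.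
by rewrite addrAC subrr add0r.
Qed.

Lemma generator_independent (lam : 'I_m.+1 -> bool) :
  \sum_i generator i *+ lam i = 0 -> forall i, lam i = false.
Proof.
under eq_bigr => i _ do rewrite -raddfMn.
rewrite -raddf_sum => /cycle_class_eq0[c].
rewrite raddf_sum /=; under eq_bigr => i _ do rewrite raddfMn /=.
pose lam' i := lam (inord i).
have lamE i : lam i = lam' i by rewrite /lam' inord_val.
under eq_bigr => i _ do rewrite lamE.
rewrite (sum_generating_chain (fun y i => y *+ lam' i)).
case/chains_independent => lam0 lamm i; rewrite lamE.
have := ltn_ord i; rewrite ltnS leq_eqVlt => /orP[/eqP->|] //.
exact: lam0.
Qed.

End SchurIso.

Local Close Scope ring_scope.
Local Close Scope group_scope.

Theorem theorem2 (n : nat) (n_ge3 : 3 <= n) :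
  zmod_isomorphic (schur_multiplier (grigorchuk_quotient n))
                  {ffun 'I_(2 * n - 2) -> 'Z_2}.
Proof.
case: n n_ge3 => [|[|[|k]]] // _.
have -> : 2 * k.+3 - 2 = (2 * k + 3).+1 by rewrite !mulnS addKn add2n add2n addn3.
exact: elementary_abelian_iso (@generator2 k) (@generator_span k)
  (@generator_independent k).
Qed.
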